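(* Let $\alpha=a_1a_2\ldots$ and $\beta=b_1b_2\ldots$ be two arbitrary infinite binary sequences. The following five definitions of the conditional finite-state dimension $\dim(\alpha\,|\,\beta)$ are equivalent, i.e. all five expressions have the same value (in particular the limit over $k$ in (1) exists): \begin{enumerate} \item[(1)] (block entropy) $\displaystyle \lim_{k\to\infty}\ \liminf_{N\to\infty} \frac{H_{k,N}(\alpha\,|\,\beta)}{k}$; \item[(2)] (finite-state gambling) $\displaystyle 1-\sup_G\ \limsup_{N\to\infty}\frac{\log_2 m_G(a_1\ldots a_N\,|\,b_1\ldots b_{N+c})}{N}$, where the supremum is over all finite-state gambling strategies $G$ with arbitrary look-ahead constants $c=c(G)$; \item[(3)] (automatic complexity) $\displaystyle \inf_D\ \liminf_{N\to\infty}\frac{\mathrm{C}_D(a_1\ldots a_N\,|\,b_1\ldots b_N)}{N}$, where the infimum is over all automatic description modes $D$; \item[(4)] (superadditive complexity measures) $\displaystyle \inf_K\ \liminf_{N\to\infty}\frac{K(a_1\ldots a_N\,|\,b_1\ldots b_N)}{N}$, where the infimum is over all superadditive complexity measures $K$; \item[(5)] (finite-state a priori complexity) $\displaystyle \inf_{M,c}\ \liminf_{N\to\infty}\frac{\mathrm{KA}_M(a_1\ldots a_N\,|\,b_{1+c}\ldots b_{N+c})}{N}$, where the infimum is over all finite-state probabilistic processes $M$ and all non-negative integers $c$. \end{enumerate} Likewise, the following five definitions of the conditional strong finite-state dimension $\mathrm{Dim}(\alpha\,|\,\beta)$ are equivalent, i.e. all five expressions have the same value (in particular the limit over $k$ in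 (1$'$) exists): \begin{enumerate} \item[(1$'$)] $\displaystyle \lim_{k\to\infty}\ \limsup_{N\to\infty} \frac{H_{k,N}(\alpha\,|\,\beta)}{k}$; \item[(2$'$)] $\displaystyle 1-\sup_G\ \liminf_{N\to\infty}\frac{\log_2 m_G(a_1\ldots a_N\,|\,b_1\ldots b_{N+c})}{N}$; \item[(3$'$)] $\displaystyle \inf_D\ \limsup_{N\to\infty}\frac{\mathrm{C}_D(a_1\ldots a_N\,|\,b_1\ldots b_N)}{N}$; \item[(4$'$)] $\displaystyle \inf_K\ \limsup_{N\to\infty}\frac{K(a_1\ldots a_N\,|\,b_1\ldots b_N)}{N}$; \item[(5$'$)] $\displaystyle \inf_{M,c}\ \limsup_{N\to\infty}\frac{\mathrm{KA}_M(a_1\ldots a_N\,|\,b_{1+c}\ldots b_{N+c})}{N}$, \end{enumerate} with suprema and infima over the same classes as in (2)--(5).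
   Context: All strings are finite binary strings; $|X|$ is the length of $X$; logarithms and entropies are to base $2$; $\log_2 0=-\infty$, and the minimum over an empty set is $+\infty$. \textbf{Block entropy.} For positive integers $k,N$, split the first $Nk$ bits of $\alpha$ and of $\beta$ into $N$ consecutive blocks of length $k$: $A_1,\ldots,A_N$ (from $\alpha$) and $B_1,\ldots,B_N$ (from $\beta$). For $i$ uniformly random in $\{1,\ldots,N\}$, let $\mathcal A=A_i$ and $\mathcal B=B_i$ (jointly distributed random variables). $H_{k,N}(\alpha\,|\,\beta)$ is the conditional Shannon entropy $H(\mathcal A\,|\,\mathcal B)$. \textbf{Finite-state gambling strategy.} A finite-state strategy $G$ consists of a constant $c\ge 0$ (look-ahead), a finite set $S$ of states with a chosen initial state, and a transition function that, given the current state $s\in S$, the last observed bit $a_{i-1}$, and the oracle bits $b_i\ldots b_{i+c}$, determines the next state and the ratio of bets, i.e. rational non-negative fractions $q_0,q_1$ with $q_0+q_1=1$ (for $i=1$, where there is no previous bit, put $a_0=0$). The game: the gambler starts with capital $1$; in round $i=1,2,\ldots$, before seeing $a_i$, she bets the fraction $q_0$ of her current capital on $0$ and the fraction $q_1$ on $1$; then $a_i$ is revealed, the part bet on $a_i$ is doubled and the other part is lost (so the capital is multiplied by $2q_{a_i}$). $m_G(a_1\ldots a_N\,|\,b_1\ldots b_{N+c})$ is the capital after $N$ rounds. \textbf{Automatic description mode.} Let $\Gamma$ be a finite directed graph (loops and parallel edges allowed) whose edges are labeled by pairs $(l,p)$, where $p$ is either a bit or the special symbol $\varepsilon$, and $l$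 is either a pair of bits $(a,b)$ or the special symbol $\varepsilon$. For every walk in $\Gamma$ (with arbitrary first and last vertices, length zero allowed) read the labels along it, skipping the symbols $\varepsilon$: the bits $a$ form a string $A$, the bits $b$ form a string $B$ (so $|A|=|B|$), and the bits $p$ form a string $P$. Let $D$ be the set of all triples $(A,B,P)$ obtained in this way. $D$ is called an automatic description mode if there is a constant $c$ such that for all $B,P$ there are at most $c$ strings $A$ with $(A,B,P)\in D$. For strings $A,B$ with $|A|=|B|$ put $\mathrm C_D(A\,|\,B)=\min\{|P| : (A,B,P)\in D\}$. \textbf{Superadditive complexity measure.} A function $K(A\,|\,B)$ defined on pairs of binary strings with $|A|=|B|$, with non-negative real values, such that (i) $K(A_1A_2\,|\,B_1B_2)\ge K(A_1\,|\,B_1)+K(A_2\,|\,B_2)$ for all $A_1,A_2,B_1,B_2$ with $|A_1|=|B_1|$, $|A_2|=|B_2|$; and (ii) there is a constant $c$ such that for every number $m$ and every string $B$ there are at most $c2^m$ strings $A$ (with $|A|=|B|$) such that $K(A\,|\,B)\le m$. No computability is assumed. \textbf{Finite-state a priori complexity.} A finite-state probabilistic process $M$ is a finite set of states together with, for every state $s$ and every condition bit $b\in\{0,1\}$, two outgoing edges (to some states), one for output bit $0$ and one for output bit $1$, labeled with rational non-negative numbers with sum $1$. These are the probabilities, when in state $s$ and reading condition bit $b$, to emit the corresponding output bit and move to the end state of that edge. For a state $s$ and strings $A,B$ with $|A|=|B|$, $m_{M,s}(A\,|\,B)$ is the probability that the process started at $s$ and reading successively the bits of $B$ outputs $A$.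 Put $\mathrm{KA}_M(A\,|\,B)=-\log_2\max_s m_{M,s}(A\,|\,B)$ (which is $+\infty$ if the maximum is $0$). *)

(* Defs.v *)
From mathcomp Require Export all_boot all_order all_algebra finmap.
From mathcomp Require Export all_classical all_reals all_analysis.

Set Implicit Arguments.
Unset Strict Implicit.
Unset Printing Implicit Defensive.
Import Order.TTheory GRing.Theory Num.Theory.
Local Open Scope classical_set_scope.
Local Open Scope ring_scope.

(* Infinite binary sequences are functions nat -> bool, with a_(i+1) = alpha i;
   the bits 0 and 1 are false and true. *)
Notation bitstring := (seq bool).

(* [substring alpha c N] is a_(1+c) ... a_(N+c). *)
Definition substring (alpha : nat -> bool) (c N : nat) : bitstring :=
  mkseq (fun i => alpha (c + i)%N) N.

Definition log2 (R : realType) (x : R) : R := ln x / ln 2.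

(* For x >= 0, with log2e 0 = -oo. *)
Definition log2e (R : realType) (x : R) : \bar R := (lne x%:E / (ln 2)%:E)%E.

(** Block entropy *)

(* ln 0 = 0, hence 0 * log2 0 = 0 as usual. *)
Definition entropy (R : realType) (T : finType) (p : T -> R) : R :=
  - \sum_(x : T) p x * log2 (p x).

(* Distribution of X i for i uniformly random in I. *)
Definition unif_dist (R : realType) (I T : finType) (X : I -> T) (x : T) : R :=
  #|[set i | X i == x]%SET|%:R / #|I|%:R.

(* H(X | Y) is the mean over y of the entropy of X conditioned on Y = y; the
   values y of probability 0 contribute 0. *)
Definition cond_entropy (R : realType) (I T U : finType)
    (X : I -> T) (Y : I -> U) : R :=
  \sum_(y : U) unif_dist R Y y *
    entropy (fun x : T =>
      unif_dist R (fun i => (X i, Y i)) (x, y) / unif_dist R Y y).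

Definition block (k : nat) (alpha : nat -> bool) (i : nat) : k.-tuple bool :=
  [tuple alpha (i * k + j)%N | j < k].

Definition block_entropy (R : realType) (k N : nat) (alpha beta : nat -> bool) : R :=
  cond_entropy R (fun i : 'I_N => block k alpha i) (fun i : 'I_N => block k beta i).

(** Finite-state gambling *)

(* The transition function is given by its two components: in state s, with
   last observed bit a and visible oracle bits w = b_i ... b_(i+c),
   [gs_next s a w] is the next state and [gs_bet s a w x] the fraction of the
   capital bet on x. *)
Record gambling_strategy := GamblingStrategy {
  gs_lookahead : nat;
  gs_state : finType;
  gs_init : gs_state;
  gs_next : gs_state -> bool -> gs_lookahead.+1.-tuple bool -> gs_state;
  gs_bet : gs_state -> bool -> gs_lookahead.+1.-tuple bool -> bool -> rat;
  gs_bet_ge0 : forall s a w x, 0 <= gs_bet s a w x;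
  gs_bet_sum1 : forall s a w, gs_bet s a w false + gs_bet s a w true = 1
}.

(* The default value of nth is not used when |B| = |A| + c. *)
Definition oracle_window (c : nat) (B : bitstring) : c.+1.-tuple bool :=
  [tuple nth false B j | j < c.+1].

Fixpoint capital_from (G : gambling_strategy) (s : gs_state G) (last : bool)
    (A B : bitstring) : rat :=
  if A is a :: A' then
    let w := oracle_window (gs_lookahead G) B in
    2 * gs_bet s last w a * capital_from (gs_next s last w) a A' (behead B)
  else 1.

(* m_G(A | B), for |B| = |A| + gs_lookahead G. *)
Definition capital (G : gambling_strategy) (A B : bitstring) : rat :=
  capital_from (gs_init G) false A B.

(** Automatic complexity *)

(* None stands for the label epsilon. *)
Record labeled_graph := LabeledGraph {
  lg_vertex : finType;
  lg_edge : finType;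
  lg_src : lg_edge -> lg_vertex;
  lg_dst : lg_edge -> lg_vertex;
  lg_io : lg_edge -> option (bool * bool);
  lg_descr : lg_edge -> option bool
}.

Fixpoint is_walk (Gamma : labeled_graph) (v : lg_vertex Gamma)
    (w : seq (lg_edge Gamma)) : bool :=
  if w is e :: w' then (lg_src e == v) && is_walk (lg_dst e) w' else true.

(* (A, B, P) \in D, for the D read off the graph Gamma. *)
Definition describes (Gamma : labeled_graph) (A B P : bitstring) : Prop :=
  exists (v : lg_vertex Gamma) (w : seq (lg_edge Gamma)),
    [/\ is_walk v w,
        A = pmap (fun e => omap fst (lg_io e)) w,
        B = pmap (fun e => omap snd (lg_io e)) w &
        P = pmap (fun e => lg_descr e) w].

Definition description_mode (Gamma : labeled_graph) : Prop :=
  exists c : nat, forall B P : bitstring,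
    ([set A | describes Gamma A B P] #<= `I_c)%card.

(* An infimum of natural numbers in \bar R: the minimum, or +oo when there is
   no description. *)
Definition automatic_complexity (R : realType) (Gamma : labeled_graph)
    (A B : bitstring) : \bar R :=
  ereal_inf [set (size P)%:R%:E | P in [set P | describes Gamma A B P]].

(** Superadditive complexity measures *)

(* K is total, but only its values on pairs of strings of equal length are
   constrained (or ever used). *)
Record superadditive_measure (R : realType) (K : bitstring -> bitstring -> R) :
    Prop := SuperadditiveMeasure {
  sm_ge0 : forall A B : bitstring, size A = size B -> 0 <= K A B;
  sm_superadditive : forall A1 A2 B1 B2 : bitstring,
    size A1 = size B1 -> size A2 = size B2 ->
    K A1 B1 + K A2 B2 <= K (A1 ++ A2) (B1 ++ B2);
  sm_calibrated : exists c : R, forall (m : R) (B : bitstring),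
    let X := [set A : bitstring | size A = size B /\ K A B <= m] in
    finite_set X /\ #|` fset_set X|%:R <= c * 2 `^ m
}.

(** Finite-state a priori complexity *)

(* The edge from s for condition bit b and output bit a leads to
   [ps_next s b a] and is labeled with [ps_prob s b a]. *)
Record prob_process := ProbProcess {
  ps_state : finType;
  ps_next : ps_state -> bool -> bool -> ps_state;
  ps_prob : ps_state -> bool -> bool -> rat;
  ps_prob_ge0 : forall s b a, 0 <= ps_prob s b a;
  ps_prob_sum1 : forall s b, ps_prob s b false + ps_prob s b true = 1
}.

(* m_(M,s)(A | B): the output bits determine the path, so its probability is
   the product of the labels. *)
Fixpoint output_prob (M : prob_process) (s : ps_state M) (A B : bitstring) : rat :=
  match A, B with
  | [::], [::] => 1
  | a :: A', b :: B' => ps_prob s b a * output_prob (ps_next s b a) A' B'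
  | _, _ => 0
  end.

Definition apriori_complexity (R : realType) (M : prob_process)
    (A B : bitstring) : \bar R :=
  (- log2e (ratr (\big[Num.max/0%R]_(s : ps_state M) output_prob s A B) : R))%E.

(* Main.v *)
Require Import Defs.
From mathcomp Require Import all_boot all_order all_algebra.
From mathcomp Require Import all_classical all_reals all_analysis.
From mathcomp Require Import zify ring lra.


(* For fixed alpha and beta, the cost of a gambling strategy, a description
   mode, a superadditive measure or a process is the function of N whose
   quotient by N appears in the corresponding definition (for gambling,
   N - log2 m_G).  Two bounds relate the costs of each class to the
   normalized block entropies h(k, n) = H_{k,n} / k.

   Lower bound: a cost that is superadditive in the position and takes values
   at most m on at most C 2^m blocks, for each condition block, is at least the
   sum of its values on the blocks of length k, and almost satisfies the Kraft
   inequality there; Gibbs' inequality bounds it below by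
   N (h(k, N/k) - O(log k / k)) - k.  The shift of the condition in the a priori
   complexity only multiplies C by 2^c, and a strategy is a process with a
   shifted condition.

   Upper bound: for given k, the mixture over finitely many bit predictors for
   k-blocks, restarted on every block of a large length L, costs at most
   N (h(k, N/k) + e) + O(1).  Using a mixture on long blocks, instead of one
   predictor, makes the same strategy good for all N, as needed for the strong
   dimension.  The mixture yields a strategy, hence a process, and a prefix code
   for L-blocks, hence a graph, whose complexity is a superadditive measure.

   The bounds hold for every k, so both lim inf and lim sup over N of h(k, N)
   converge as k grows, to the infimum of the limits of the costs. *)

Set Implicit Arguments.
Unset Strict Implicit.
Unset Printing Implicit Defensive.
Import Order.TTheory GRing.Theory Num.Theory.
Import numFieldNormedType.Exports.
Local Open Scope classical_set_scope.
Local Open Scope ring_scope.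

(** * Limits of costs *)

Lemma near_divn (k : nat) (P : nat -> Prop) : (0 < k)%N ->
  (\forall n \near \oo, P n) -> \forall n \near \oo, P (n %/ k)%N.
Proof.
move=> k0 [N _ NP]; exists (N * k)%N => // n /= Nkn.
by apply: NP => /=; rewrite leq_divRL.
Qed.

Lemma near_muln (k : nat) (P : nat -> Prop) : (0 < k)%N ->
  (\forall n \near \oo, P n) -> \forall n \near \oo, P (n * k)%N.
Proof.
move=> k0 [N _ NP]; exists N => // n /= Nn.
by apply: NP => /=; rewrite (leq_trans Nn)// leq_pmulr.
Qed.

(** [limn_esup u] is the infimum, over the sets [V] of the filter, of the supremum of [u] on [V];
    such a [V] may be intersected with the set where the inequality holds. *)
Lemma limn_esup_near_le (R : realType) (u v : nat -> \bar R) :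
  (\forall n \near \oo, (u n <= v n)%E) -> (limn_esup u <= limn_esup v)%E.
Proof.
move=> uv; apply: le_ereal_inf_tmp => _ [V oV <-].
pose V' := V `&` [set n | (u n <= v n)%E].
have oV' : \oo V' by exact: filterI.
apply: (@le_trans _ _ (ereal_sup (u @` V'))).
  by apply: ereal_inf_lbound; exists V'.
apply: ge_ereal_sup => _ [n [Vn uvn] <-].
by apply: (le_trans uvn); apply: ereal_sup_ubound; exists n.
Qed.

(** Large sets of indices stay large under preimage by [n %/ k] and by [n * k]. A cost at length [N]
    is compared with the entropy of [N %/ k] blocks, so this reindexing removes the quotient. *)
Lemma limn_esup_divn (R : realType) (u : nat -> \bar R) (k : nat) : (0 < k)%N ->
  limn_esup (fun n => u (n %/ k)%N) = limn_esup u.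
Proof.
move=> k0; apply/eqP; rewrite eq_le; apply/andP; split;
    apply: le_ereal_inf_tmp => _ [V oV <-].
  pose V' := [set n | V (n %/ k)%N].
  apply: (@le_trans _ _ (ereal_sup ((fun n => u (n %/ k)%N) @` V'))).
    by apply: ereal_inf_lbound; exists V' => //; exact: near_divn.
  apply: ge_ereal_sup => _ [n Vn <-].
  by apply: ereal_sup_ubound; exists (n %/ k)%N.
pose V' := [set n | V (n * k)%N].
apply: (@le_trans _ _ (ereal_sup (u @` V'))).
  by apply: ereal_inf_lbound; exists V' => //; exact: near_muln.
apply: ge_ereal_sup => _ [n Vn <-].
by apply: ereal_sup_ubound; exists (n * k)%N => //; rewrite mulnK.
Qed.

(* The properties shared by [limn_einf] and [limn_esup] on which the
   equivalence of the definitions relies, so that both dimensions are treated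
   at once. *)
Record limit_functional (R : realType) (Lam : (nat -> \bar R) -> \bar R) : Prop :=
  LimitFunctional {
    lam_le : forall u v : nat -> \bar R,
      (\forall n \near \oo, (u n <= v n)%E) -> (Lam u <= Lam v)%E;
    lam_shift : forall (u : nat -> \bar R) (e : R),
      Lam (fun n => (e%:E + u n)%E) = (e%:E + Lam u)%E;
    lam0 : Lam (fun=> 0%E) = 0%E;
    lam_divn : forall (u : nat -> \bar R) (k : nat), (0 < k)%N ->
      Lam (fun n => u (n %/ k)%N) = Lam u
  }.

Lemma limn_einf_functional (R : realType) : limit_functional (@limn_einf R).
Proof.
split.
- move=> u v uv; rewrite /limn_einf leeN2; apply: limn_esup_near_le.
  by apply: filterS uv => n; rewrite leeN2.
- by move=> u e; exact: limn_einf_shift.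
- by have [-> _] := @cvg_limn_einf_sup R (fun=> 0%E) 0%E (cvg_cst _).
- by move=> u k k0; rewrite /limn_einf -[in RHS](limn_esup_divn _ k0).
Qed.

Lemma limn_esup_functional (R : realType) : limit_functional (@limn_esup R).
Proof.
split.
- exact: limn_esup_near_le.
(* The shift rule for the upper limit is that of the lower limit, conjugated by negation. *)
- move=> u e; apply: oppe_inj; rewrite -!limn_einfN.
  rewrite oppeD// -limn_einfN -EFinN -limn_einf_shift//.
  by congr limn_einf; apply/funext => n /=; rewrite oppeD.
- by have [_ ->] := @cvg_limn_einf_sup R (fun=> 0%E) 0%E (cvg_cst _).
- by move=> u k k0; exact: limn_esup_divn.
Qed.

Lemma lam_cst (R : realType) (Lam : (nat -> \bar R) -> \bar R) (e : R) :
  limit_functional Lam -> Lam (fun=> e%:E) = e%:E.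
Proof.
move=> HL; have := lam_shift HL (fun=> 0%E) e.
by rewrite (lam0 HL) adde0.
Qed.

(** The cost is chosen before [N]: a single one must serve all lengths, as the upper limits
    require. *)
Definition cost_upper_bound (R : realType) (h : nat -> nat -> R)
    (Cl : set (nat -> \bar R)) : Prop :=
  forall (k : nat) (e : R), (0 < k)%N -> 0 < e ->
    exists2 c, Cl c & exists C : R, forall N : nat,
      (c N <= (N%:R * (h k (N %/ k)%N + e) + C)%:E)%E.

(** The error [w k] is per bit and vanishes for long blocks; [C k] disappears on division by [N]. *)
Definition cost_lower_bound (R : realType) (h : nat -> nat -> R)
    (Cl : set (nat -> \bar R)) : Prop :=
  forall c, Cl c -> exists2 w : nat -> R, w @ \oo --> 0 &
    exists C : nat -> R, forall k N : nat, (0 < k)%N ->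
      ((N%:R * (h k (N %/ k)%N - w k) - C k)%:E <= c N)%E.

Lemma near_natr_ge (R : realType) (C e : R) : 0 < e ->
  \forall N \near \oo, (0 < N)%N /\ C / N%:R <= e.
Proof.
move=> e0; exists (Num.truncn (`|C| / e)).+1 => // N /= CN.
have N0 : (0 < N)%N by exact: leq_trans CN.
split => //; rewrite ler_pdivrMr ?ltr0n// mulrC -ler_pdivrMr//.
apply: (@le_trans _ _ (`|C| / e)); first by rewrite ler_pM2r ?invr_gt0// ler_norm.
apply/ltW; apply: (@lt_le_trans _ _ (Num.truncn (`|C| / e)).+1%:R).
  exact: truncnS_gt.
by rewrite ler_nat.
Qed.

Lemma le_divn_EFin (R : realType) (x : \bar R) (N : nat) (e : R) : (0 < N)%N ->
  (x / N%:R%:E <= e%:E)%E = (x <= (e * N%:R)%:E)%E.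
Proof.
by move=> N0; rewrite inver gt_eqF ?ltr0n// lee_pdivrMr ?ltr0n// EFinM.
Qed.

Lemma ge_divn_EFin (R : realType) (x : \bar R) (N : nat) (e : R) : (0 < N)%N ->
  (e%:E <= x / N%:R%:E)%E = ((e * N%:R)%:E <= x)%E.
Proof.
by move=> N0; rewrite inver gt_eqF ?ltr0n// lee_pdivlMr ?ltr0n// EFinM.
Qed.

(** The upper bound puts the infimum below [x k] for every positive [k]; the lower bound puts [x k],
    for large [k], below the limit of any given cost up to [e]. Hence [x k] converges to the
    infimum, and the existence of the limit comes out as a consequence. *)
Lemma inf_cost_limit (R : realType) (Lam : (nat -> \bar R) -> \bar R)
    (h : nat -> nat -> R) (Cl : set (nat -> \bar R)) :
  limit_functional Lam -> (forall k n, 0 <= h k n <= 1) ->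
  cost_upper_bound h Cl -> cost_lower_bound h Cl ->
  (exists d : R,
    ereal_inf [set Lam (fun N => (c N / N%:R%:E)%E) | c in Cl] = d%:E) /\
  (fun k => Lam (fun n => (h k n)%:E)) @ \oo -->
    ereal_inf [set Lam (fun N => (c N / N%:R%:E)%E) | c in Cl].
Proof.
move=> HL h01 HU HW.
set v := ereal_inf _.
pose x k := Lam (fun n => (h k n)%:E).
have x0 k : (0 <= x k)%E.
  rewrite -(lam0 HL); apply: (lam_le HL); near=> n.
  by rewrite lee_fin; case/andP: (h01 k n).
have x1 k : (x k <= 1)%E.
  rewrite -[1%E](lam_cst 1 HL); apply: (lam_le HL); near=> n.
  by rewrite lee_fin; case/andP: (h01 k n).
have vx k : (0 < k)%N -> (v <= x k)%E.
  move=> k0; apply/lee_addgt0Pr => e e0.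
  have e20 : 0 < e / 2 by rewrite divr_gt0.
  have [c Clc [C HC]] := HU k (e / 2) k0 e20.
  apply: (@le_trans _ _ (Lam (fun N => (c N / N%:R%:E)%E))).
    by apply: ereal_inf_lbound; exists c.
  (* Passing from [n] blocks to [N %/ k] blocks makes both sides functions of the same length. *)
  rewrite addeC /x -(lam_divn HL (fun n => (h k n)%:E) k0) -(lam_shift HL); apply: (lam_le HL).
  have := near_natr_ge C e20; apply: filterS => N [N0 CN].
  rewrite -EFinD le_divn_EFin//; apply: (le_trans (HC N)).
  rewrite lee_fin.
  by move: CN; rewrite ler_pdivrMr ?ltr0n// => CN; lra.
have xc c : Cl c -> forall e : R, 0 < e -> \forall k \near \oo,
    (x k <= Lam (fun N => (c N / N%:R%:E)%E) + e%:E)%E.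
  move=> Clc e e0.
  have e20 : 0 < e / 2 by rewrite divr_gt0.
  have [w w0 [C HC]] := HW c Clc.
  have wk : \forall k \near \oo, w k < e / 2.
    exact: (cvgr_lt (0:R) w0 (e/2) e20).
  near=> k.
  have k0 : (0 < k)%N by near: k; exists 1%N.
  rewrite addeC /x -(lam_divn HL (fun n => (h k n)%:E) k0) -(lam_shift HL); apply: (lam_le HL).
  have := near_natr_ge (C k) e20; apply: filterS => N [N0 CN].
  rewrite -leeBlDl// -EFinB ge_divn_EFin//.
  apply: le_trans (HC k N k0); rewrite lee_fin.
  move: CN; rewrite ler_pdivrMr ?ltr0n// => CN.
  have : N%:R * w k <= N%:R * (e / 2).
    by rewrite ler_pM2l ?ltr0n//; apply/ltW; near: k.
  lra.
have v0 : (0 <= v)%E.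
  apply: le_ereal_inf_tmp => _ [c Clc <-]; apply/lee_addgt0Pr => e e0.
  have [k _ Hk] := xc c Clc e e0.
  exact: le_trans (x0 k) (Hk k (leqnn k)).
(* Both the infimum and all [x k] lie between [0] and [1], so convergence can be proved for real
   numbers. *)
have v1 : (v <= 1)%E by exact: le_trans (vx 1%N isT) (x1 1%N).
have vfin : v \is a fin_num by rewrite fin_numE -ltey -ltNye
  (le_lt_trans v1 (ltry _)) (lt_le_trans (ltNyr _) v0).
split; first by exists (fine v); rewrite fineK.
have xfin k : x k \is a fin_num by rewrite fin_numE -ltey -ltNye
  (le_lt_trans (x1 k) (ltry _)) (lt_le_trans (ltNyr _) (x0 k)).
rewrite -(fineK vfin); apply/fine_cvgP; split; first by near=> k; exact: xfin.
apply/cvgrPdist_le => e e0.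
have e20 : 0 < e / 2 by rewrite divr_gt0.
have [_ [c Clc <-] cv] := lb_ereal_inf_adherent e20 vfin.
have xcn := xc c Clc _ e20.
near=> k.
have k0 : (0 < k)%N by near: k; exists 1%N.
have h1 : fine v <= fine (x k) by rewrite -lee_fin !fineK// vx.
have h2 : fine (x k) <= fine v + e.
  rewrite -lee_fin EFinD !fineK// (splitr e) EFinD addeA.
  apply: (@le_trans _ _ (Lam (fun N => c N / N%:R%:E) + (e / 2)%:E)%E).
    by near: k.
  by rewrite leeD2r// ltW.
by rewrite distrC ger0_norm ?subr_ge0// lerBlDl.
Unshelve. all: by end_near.
Qed.

(** * Conditional entropy *)

Lemma ln2_gt0 (R : realType) : 0 < ln 2 :> R.
Proof. by rewrite ln_gt0 // ltr1n. Qed.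

Lemma log2_1 (R : realType) : log2 1 = 0 :> R.
Proof. by rewrite /log2 ln1 mul0r. Qed.

Lemma log2_2 (R : realType) : log2 2 = 1 :> R.
Proof. by rewrite /log2 divff// gt_eqF// ln2_gt0. Qed.

Lemma log2M (R : realType) (x y : R) : 0 < x -> 0 < y ->
  log2 (x * y) = log2 x + log2 y.
Proof. by move=> x0 y0; rewrite /log2 lnM ?posrE// mulrDl. Qed.

Lemma log2V (R : realType) (x : R) : 0 < x -> log2 x^-1 = - log2 x.
Proof. by move=> x0; rewrite /log2 lnV ?posrE// mulNr. Qed.

Lemma log2_div (R : realType) (x y : R) : 0 < x -> 0 < y ->
  log2 (x / y) = log2 x - log2 y.
Proof. by move=> x0 y0; rewrite log2M ?invr_gt0// log2V. Qed.

Lemma log2X (R : realType) (x : R) n : 0 < x -> log2 (x ^+ n) = n%:R * log2 x.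
Proof. by move=> x0; rewrite /log2 lnXn// mulr_natl mulrnAl. Qed.

Lemma log2_pow2 (R : realType) n : log2 (2 ^+ n) = n%:R :> R.
Proof. by rewrite log2X// log2_2 mulr1. Qed.

Lemma ler_log2 (R : realType) (x y : R) : 0 < x -> x <= y -> log2 x <= log2 y.
Proof.
move=> x0 xy; rewrite /log2 ler_pM2r ?invr_gt0 ?ln2_gt0//.
by rewrite ler_ln ?posrE// (lt_le_trans x0).
Qed.

Lemma log2_le0 (R : realType) (x : R) : 0 < x -> x <= 1 -> log2 x <= 0.
Proof. by move=> x0 x1; rewrite -(log2_1 R) ler_log2. Qed.

Lemma log2_ge0 (R : realType) (x : R) : 1 <= x -> 0 <= log2 x.
Proof. by move=> x1; rewrite -(log2_1 R) ler_log2. Qed.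

Lemma log2_prod (R : realType) (I : Type) (s : seq I) (P : pred I) (f : I -> R) :
  (forall i, P i -> 0 < f i) ->
  log2 (\prod_(i <- s | P i) f i) = \sum_(i <- s | P i) log2 (f i).
Proof.
move=> f0.
(* Positivity of the partial products is carried through the induction because [log2M] asks for
   it. *)
suff: 0 < \prod_(i <- s | P i) f i /\
  log2 (\prod_(i <- s | P i) f i) = \sum_(i <- s | P i) log2 (f i) by case.
elim/big_rec2: _ => [|i y1 y2 Pi [y20 y2y1]]; first by rewrite log2_1.
by rewrite mulr_gt0 ?f0// log2M ?f0// y2y1.
Qed.

Lemma unif_dist_ge0 (R : realType) (I T : finType) (X : I -> T) (x : T) :
  0 <= unif_dist R X x.
Proof. by rewrite divr_ge0. Qed.

(** Grouping the indices by the value of [X]; the factor [#|I|] lets the identity include an empty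
    [I]. *)
Lemma sum_unif_dist (R : realType) (I T : finType) (X : I -> T) (f : T -> R) :
  #|I|%:R * \sum_(x : T) unif_dist R X x * f x = \sum_(i : I) f (X i).
Proof.
have [I0|I0] := eqVneq #|I| 0%N.
  rewrite I0 mul0r big1// => i _.
  by have := max_card (pred1 i); rewrite I0 card1.
rewrite mulr_sumr (partition_big X xpredT)//=; apply: eq_bigr => x _.
rewrite mulrA /unif_dist mulrCA divff ?pnatr_eq0// mulr1.
rewrite mulrC (eq_bigr (fun=> f x)) => [|i /eqP->//].
rewrite sumr_const mulr_natr; congr (_ *+ _).
by apply: eq_card => i; rewrite inE.
Qed.

Lemma unif_dist_pair_le (R : realType) (I T U : finType) (X : I -> T) (Y : I -> U) x y :
  unif_dist R (fun i => (X i, Y i)) (x, y) <= unif_dist R Y y.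
Proof.
rewrite /unif_dist ler_wpM2r// ler_nat subset_leq_card//.
by apply/fintype.subsetP => i; rewrite !inE => /eqP[_ ->].
Qed.

Lemma unif_dist_gt0 (R : realType) (I T : finType) (X : I -> T) i :
  0 < unif_dist R X (X i).
Proof.
rewrite divr_gt0// ltr0n; apply/card_gt0P; exists i => //.
by rewrite inE.
Qed.

(** Conditional entropy is the mean of the conditional surprisal; written as a sum over the samples,
    it can be compared with a cost block by block. *)
Lemma cond_entropy_sum (R : realType) (I T U : finType) (X : I -> T) (Y : I -> U) :
  #|I|%:R * cond_entropy R X Y =
  \sum_(i : I) - log2 (unif_dist R (fun i => (X i, Y i)) (X i, Y i) / unif_dist R Y (Y i)).
Proof.
pose XY i := (X i, Y i).
pose f (z : T * U) := - log2 (unif_dist R XY z / unif_dist R Y z.2).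
rewrite -[RHS](sum_unif_dist XY f); congr (_ * _).
rewrite /cond_entropy.
rewrite (eq_bigr (fun y => \sum_x unif_dist R XY (x, y) * f (x, y))); last first.
  move=> y _; rewrite /entropy -sumrN mulr_sumr; apply: eq_bigr => x _.
  rewrite /f/= mulrN -!mulrN mulrA; congr (_ * _).
  (* A condition of probability zero also has zero joint probabilities. *)
  have [y0|y0] := eqVneq (unif_dist R Y y) 0; last by rewrite mulrCA divff// mulr1.
  rewrite y0 mul0r; apply/eqP; rewrite eq_sym eq_le unif_dist_ge0 andbT.
  by rewrite -y0 unif_dist_pair_le.
rewrite exchange_big pair_big/=.
by apply: eq_bigr => -[].
Qed.

(** Gibbs' inequality for weights of total at most [W]: apply [ln z <= z - 1] to the ratio of
    [w / W] to the empirical conditional probability [p]. The mean of this ratio is at most one. *)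
Lemma cond_entropy_gibbs (R : realType) (I T U : finType) (X : I -> T) (Y : I -> U)
    (w : T -> U -> R) (W : R) :
  0 < W -> (forall x y, 0 < w x y) -> (forall y, \sum_x w x y <= W) ->
  #|I|%:R * (cond_entropy R X Y - log2 W) <= \sum_(i : I) - log2 (w (X i) (Y i)).
Proof.
move=> W0 w0 wW; rewrite mulrBr cond_entropy_sum.
pose XY i := (X i, Y i).
pose p (z : T * U) := unif_dist R XY z / unif_dist R Y z.2.
have p0 i : 0 < p (XY i) by rewrite divr_gt0 ?unif_dist_gt0.
have key : \sum_(i : I) w (X i) (Y i) / (W * p (XY i)) <= #|I|%:R.
  rewrite -(sum_unif_dist XY (fun z => w z.1 z.2 / (W * p z))).
  rewrite -[leRHS]mulr1 ler_wpM2l//.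
  rewrite -(pair_bigA _ (fun x y => unif_dist R XY (x, y) *
    (w x y / (W * p (x, y)))))/= exchange_big/=.
  (* Where the joint probability is positive it cancels against [p]; elsewhere the term is zero and
     only the nonnegativity of the weights is used. *)
  apply: (@le_trans _ _ (\sum_y unif_dist R Y y * (\sum_x w x y / W))).
    apply: ler_sum => y _; rewrite mulr_sumr; apply: ler_sum => x _.
    rewrite /p/=; set a := unif_dist R XY _; set b := unif_dist R Y y.
    have b0 : 0 <= b by exact: unif_dist_ge0.
    have wW0 : 0 <= w x y / W by rewrite divr_ge0// ltW.
    have [a0|a0] := eqVneq a 0; first by rewrite a0 mul0r mulr_ge0.
    have b1 : b != 0.
      apply: contra a0 => /eqP b1; rewrite eq_le unif_dist_ge0 andbT -b1.
      exact: unif_dist_pair_le.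
    rewrite le_eqVlt; apply/orP; left; apply/eqP.
    by field; rewrite a0 b1 gt_eqF.
  apply: (@le_trans _ _ (\sum_y unif_dist R Y y * 1)).
    apply: ler_sum => y _; rewrite ler_wpM2l ?unif_dist_ge0//.
    by rewrite -mulr_suml ler_pdivrMr// mul1r.
  have := sum_unif_dist Y (fun=> 1 : R); rewrite sumr_const -mulr_natl mulr1 => S.
  have [I0|I0] := eqVneq #|I| 0%N; last first.
    by rewrite -(@ler_pM2l _ #|I|%:R) ?ltr0n ?lt0n// S mulr1.
  rewrite big1// => y _; rewrite /unif_dist I0 invr0 mulr0 mul0r//.
have {key}: \sum_(i : I) ((w (X i) (Y i) / (W * p (XY i)) - 1) / ln 2) <= 0.
  rewrite -mulr_suml sumrB sumr_const pmulr_lle0 ?invr_gt0 ?ln2_gt0//.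
  by rewrite subr_le0.
rewrite -subr_ge0 => key; rewrite -subr_ge0; apply: (le_trans key).
rewrite sub0r -sumrN mulr_natl -sumr_const.
rewrite opprB addrCA -sumrB -big_split/=; apply: ler_sum => i _.
rewrite -/(p (XY i)).
have q0 : 0 < W * p (XY i) by rewrite mulr_gt0.
have -> : log2 W + (- log2 (w (X i) (Y i)) - - log2 (p (XY i))) =
   - log2 (w (X i) (Y i) / (W * p (XY i))).
  by rewrite log2_div// log2M//; ring.
rewrite lerN2 /log2 ler_pM2r ?invr_gt0 ?ln2_gt0//.
have := @le_ln1Dx R (w (X i) (Y i) / (W * p (XY i)) - 1).
rewrite [1 + _]addrC addrNK; apply; rewrite ltrBrDr addNr.
by rewrite divr_gt0.
Qed.

Lemma block_entropy_ge0 (R : realType) k N (alpha beta : nat -> bool) :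
  0 <= block_entropy R k N alpha beta.
Proof.
(* Without blocks all frequencies are quotients by zero, hence zero. *)
rewrite /block_entropy; case: N => [|N].
  rewrite /cond_entropy big1// => y _.
  by rewrite {1}/unif_dist card_ord invr0 mulr0 mul0r.
rewrite -(@pmulr_rge0 _ #|'I_N.+1|%:R) ?card_ord ?ltr0n//.
have := cond_entropy_sum R (fun i : 'I_N.+1 => block k alpha i)
  (fun i : 'I_N.+1 => block k beta i); rewrite card_ord => ->.
apply: sumr_ge0 => i _; rewrite oppr_ge0 log2_le0//.
  by rewrite divr_gt0 ?unif_dist_gt0// (unif_dist_gt0 R
    (fun i : 'I_N.+1 => (block k alpha i, block k beta i))).
rewrite ler_pdivrMr ?unif_dist_gt0// mul1r.
exact: (unif_dist_pair_le R (fun i : 'I_N.+1 => block k alpha i)).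
Qed.

(** Gibbs' inequality with all weights equal to [1] and [W = 2 ^+ k]. *)
Lemma block_entropy_le (R : realType) k N (alpha beta : nat -> bool) :
  block_entropy R k N alpha beta <= k%:R.
Proof.
rewrite /block_entropy; case: N => [|N].
  rewrite /cond_entropy big1// => y _.
  by rewrite {1}/unif_dist card_ord invr0 mulr0 mul0r.
have S (y : k.-tuple bool) : \sum_(x : k.-tuple bool) 1 <= 2 ^+ k :> R.
  by rewrite sumr_const card_tuple card_bool natrX.
have := cond_entropy_gibbs (fun i : 'I_N.+1 => block k alpha i)
  (fun i : 'I_N.+1 => block k beta i) (exprn_gt0 k (ltr0n R 2))
  (fun _ _ => ltr01) S.
rewrite log2_pow2 log2_1 oppr0 [leRHS]big1// pmulr_rle0 ?subr_le0//.
by rewrite ltr0n card_ord.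
Qed.

(** * Lower bounds *)

Lemma tval_block k (alpha : nat -> bool) i :
  tval (block k alpha i) = substring alpha (i * k) k.
Proof.
apply: (@eq_from_nth _ false); first by rewrite size_tuple size_mkseq.
move=> j; rewrite size_tuple => jk; rewrite nth_mkseq//.
by rewrite -[j]/(nat_of_ord (Ordinal jk)) -tnth_nth tnth_mktuple.
Qed.

Lemma substring_cat (alpha : nat -> bool) i m n :
  substring alpha i (m + n) = substring alpha i m ++ substring alpha (i + m) n.
Proof.
rewrite /substring /mkseq iotaD map_cat; congr (_ ++ _).
rewrite add0n -{1}[m]addn0 iotaDl -map_comp.
by apply: eq_map => j /=; rewrite addnA.
Qed.

Lemma size_substring (alpha : nat -> bool) i n : size (substring alpha i n) = n.
Proof. exact: size_mkseq. Qed.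

(** The tangent bound [ln y <= e * y - ln e] holds for every slope [e > 0], so the logarithm is
    eventually below any linear function. *)
Lemma log2_affine_div_cvg0 (R : realType) (C : R) : 0 <= C ->
  (fun k : nat => log2 (2 * C * k.+1%:R + 1) / k%:R) @ \oo --> (0 : R).
Proof.
move=> C0; apply/cvgrPdist_le => eta eta0.
have l0 := ln2_gt0 R.
(* Since [k + 1 <= 2 * k], this slope keeps [e * (2 * C * k.+1)] within half of [eta * ln 2 * k];
   the remaining constant [e - ln e] fits into the other half for large [k]. *)
pose e := eta * ln 2 / (8 * C + 1).
have C1 : 0 < 8 * C + 1 by rewrite ltr_wpDl// mulr_ge0.
have e0 : 0 < e by rewrite divr_gt0// mulr_gt0.
have eta2 : 0 < eta / 2 * ln 2 by rewrite mulr_gt0// divr_gt0.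
have := near_natr_ge (e - ln e) eta2; apply: filterS => k [k0].
rewrite ler_pdivrMr ?ltr0n// => Hk.
have W1 : 1 <= 2 * C * k.+1%:R + 1 :> R by rewrite lerDr !mulr_ge0.
have W0 : 0 < 2 * C * k.+1%:R + 1 :> R by exact: lt_le_trans W1.
rewrite distrC subr0 ger0_norm; last exact: divr_ge0 (log2_ge0 W1) (ler0n _ _).
rewrite ler_pdivrMr ?ltr0n// /log2 ler_pdivrMr//.
have : ln (2 * C * k.+1%:R + 1) <= e * (2 * C * k.+1%:R + 1) - ln e.
  rewrite lerBrDl -lnM ?posrE//.
  have := @le_ln1Dx R (e * (2 * C * k.+1%:R + 1) - 1).
  rewrite [1 + _]addrC addrNK => H; apply: (le_trans (H _)).
    by rewrite ltrBrDr addNr mulr_gt0.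
  by rewrite gerBl.
move=> /le_trans; apply.
have k1 : (1 : R) <= k%:R by rewrite ler1n.
have : e * (8 * C + 1) = eta * ln 2 by rewrite /e divfK// gt_eqF.
have : 0 <= e * C by rewrite mulr_ge0// ltW.
have : 0 <= e * C * (k%:R - 1).
  by apply: mulr_ge0; [exact: mulr_ge0 (ltW e0) C0|rewrite subr_ge0].
rewrite -natr1 => h1 h2 h3.
have : e * C * 8 * k%:R <= eta * ln 2 * k%:R.
  rewrite ler_wpM2r//; first by lra.
lra.
Qed.

(* The weights [2 ^ - kappa] given to the blocks conditioned on a fixed
   condition block almost satisfy the Kraft inequality, because [kappa] takes
   a value at most [m] on at most [C * 2 ^ m] of them; hence by Gibbs'
   inequality the sum of [kappa] over the blocks is at least the entropy. *)
Lemma superadditive_cost_ge_entropy (R : realType) (alpha beta : nat -> bool)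
    (kappa : nat -> nat -> \bar R) (C : R) :
  0 <= C ->
  (forall i n, 0 <= kappa i n)%E ->
  (forall i m n, kappa i m + kappa (i + m)%N n <= kappa i (m + n)%N)%E ->
  (forall k (B : k.-tuple bool) (m : nat),
     #|[set A : k.-tuple bool | `[< exists i, [/\ tval A = substring alpha i k,
        tval B = substring beta i k & (kappa i k <= m%:R%:E)%E] >]]%SET|%:R
     <= C * 2 ^+ m) ->
  forall k N, (0 < k)%N ->
  ((N%:R * (block_entropy R k (N %/ k) alpha beta / k%:R
     - log2 (2 * C * k.+1%:R + 1) / k%:R) - k%:R)%:E <= kappa 0%N N)%E.
Proof.
move=> C0 kappa0 kappaD kappaC k N k0.
pose S (B : k.-tuple bool) (m : nat) :=
  [set A : k.-tuple bool | `[< exists i, [/\ tval A = substring alpha i k,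
        tval B = substring beta i k & (kappa i k <= m%:R%:E)%E] >]]%SET.
(* A cost in [[m, m + 1)] is found at level [m.+1] and receives [2 ^- m], so rounding goes in the
   favourable direction; the last summand handles costs of at least [k]. Each of the [k.+1] levels
   has total weight at most [2 * C], and the last summand has total weight [1]. *)
pose w (A B : k.-tuple bool) : R :=
  \sum_(m < k.+1) (A \in S B m.+1)%:R * 2 ^- m + 2 ^- k.
pose W : R := 2 * C * k.+1%:R + 1.
have W1 : 1 <= W by rewrite lerDr !mulr_ge0.
have W0 : 0 < W by exact: lt_le_trans W1.
have p2 m : 0 < 2 ^- m :> R by rewrite invr_gt0 exprn_gt0.
have w0 A B : 0 < w A B.
  by rewrite ltr_wpDl// sumr_ge0// => m _; rewrite mulr_ge0// ltW.
have wW B : \sum_A w A B <= W.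
  rewrite big_split/= exchange_big/= lerD//; last first.
    by rewrite sumr_const card_tuple card_bool -[_ *+ _]mulr_natr natrX mulVf// expf_neq0.
  have -> : 2 * C * k.+1%:R = \sum_(j < k.+1) 2 * C :> R.
    by rewrite sumr_const card_ord mulr_natr.
  apply: ler_sum => m _; rewrite -mulr_suml ler_pdivrMr ?exprn_gt0//.
  have := kappaC k B m.+1; rewrite exprS mulrA (mulrC C 2).
  by rewrite -sum1_card natr_sum [X in X <= _ -> _]big_mkcond; apply: le_trans;
    apply: ler_sum => A _; rewrite -/(S B m.+1); case: ifP.
have wk i : ((- log2 (w (block k alpha i) (block k beta i)))%:E <= kappa (i * k)%N k)%E.
  case E : (kappa (i * k)%N k) => [v| |]; [|by rewrite leey|]; last first.
    by have := kappa0 (i * k)%N k; rewrite E.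
  have v0 : 0 <= v by have := kappa0 (i * k)%N k; rewrite E lee_fin.
  rewrite lee_fin lerNl.
  suff [m mv mw] : exists2 m : nat, m%:R <= v & 2 ^- m <= w (block k alpha i) (block k beta i).
    apply: (@le_trans _ _ (log2 (2 ^- m))).
      by rewrite log2V ?exprn_gt0// log2_pow2 lerN2.
    by rewrite ler_log2.
  have [kv|vk] := leP (k%:R) v.
    by exists k => //; rewrite lerDr sumr_ge0.
  exists (Num.truncn v); first by rewrite truncn_le.
  have mk : (Num.truncn v < k.+1)%N.
    by rewrite ltnS -(ler_nat R) (le_trans _ (ltW vk))// truncn_le.
  rewrite /w (bigD1 (Ordinal mk))//= -addrA.
  have -> : block k alpha i \in S (block k beta i) (Num.truncn v).+1.
    rewrite inE; apply/asboolP; exists (i * k)%N; split; [exact: tval_block..|].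
    by rewrite E lee_fin ltW// truncnS_gt.
  by rewrite mul1r lerDl addr_ge0 ?sumr_ge0.
have sumk n : (\sum_(i < n) kappa (i * k)%N k <= kappa 0%N (n * k)%N)%E.
  elim: n => [|n IHn]; first by rewrite big_ord0.
  rewrite big_ord_recr/= mulSn addnC.
  by apply: le_trans (kappaD _ _ _); rewrite add0n leeD2r.
set n := (N %/ k)%N.
(* The incomplete last block is dropped: its cost is nonnegative. *)
have kN : (\sum_(i < n) kappa (i * k)%N k <= kappa 0%N N)%E.
  apply: (le_trans (sumk n)).
  have -> : kappa 0%N N = kappa 0%N (n * k + N %% k)%N by rewrite -divn_eq.
  by apply: le_trans (kappaD _ _ _); rewrite leeDl.
apply: le_trans kN.
apply: (@le_trans _ _ (\sum_(i < n)
    (- log2 (w (block k alpha i) (block k beta i)))%:E)%E); last first.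
  by apply: lee_sum => i _.
rewrite sumEFin lee_fin.
have := cond_entropy_gibbs (fun i : 'I_n => block k alpha i)
  (fun i : 'I_n => block k beta i) W0 w0 wW.
apply: le_trans; rewrite -/(block_entropy R k n alpha beta) card_ord -/W.
have H0 := block_entropy_ge0 R k n alpha beta.
have H1 := block_entropy_le R k n alpha beta.
move: H0 H1; set H := block_entropy _ _ _ _ _ => H0 H1.
have l0 : 0 <= log2 W by exact: log2_ge0.
have kR : 0 < k%:R :> R by rewrite ltr0n.
have nk1 : n%:R * k%:R <= N%:R :> R by rewrite -natrM ler_nat leq_trunc_div.
have nk2 : N%:R <= n%:R * k%:R + k%:R :> R.
  rewrite -natrM -natrD ler_nat {1}(divn_eq N k) -/n leq_add2l.
  by rewrite ltnW// ltn_mod.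
(* The incomplete block accounts for at most [H <= k], which is the subtracted [k%:R] of the
   bound. *)
have h1 : N%:R * (H / k%:R) <= n%:R * H + k%:R.
  apply: (@le_trans _ _ ((n%:R * k%:R + k%:R) * (H / k%:R))).
    by rewrite ler_wpM2r// divr_ge0// ltW.
  have -> : (n%:R * k%:R + k%:R) * (H / k%:R) = n%:R * H + H.
    by field; rewrite gt_eqF.
  by rewrite lerD2l.
have h2 : n%:R * log2 W <= N%:R * (log2 W / k%:R).
  apply: le_trans (_ : (n%:R * k%:R) * (log2 W / k%:R) <= _).
    by rewrite le_eqVlt; apply/orP; left; apply/eqP; field; rewrite gt_eqF.
  by rewrite ler_wpM2r// divr_ge0// ltW.
by rewrite !mulrBr; lra.
Qed.

(** * Counting strings of low cost; superadditive measures *)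

Lemma big_tuple_cons (V : nmodType) (T : finType) n (F : seq T -> V) :
  \sum_(t : n.+1.-tuple T) F t = \sum_(x : T) \sum_(t : n.-tuple T) F (x :: t).
Proof.
rewrite pair_big/= (reindex (fun p : T * n.-tuple T => [tuple of p.1 :: p.2])).
  by apply: eq_bigr => -[].
exists (fun t => (thead t, [tuple of behead t])) => [[x t] _|t _] /=.
  by congr pair; apply/val_inj.
by apply/val_inj => /=; rewrite [in RHS](tuple_eta t).
Qed.

(** The union bound, used below over descriptions, their lengths, and the bits following a condition
    block. *)
Lemma card_le_sum (T U : finType) (S : {set T}) (X : U -> {set T}) :
  (forall t, t \in S -> exists u, t \in X u) -> (#|S| <= \sum_u #|X u|)%N.
Proof.
move=> SX; rewrite -sum1_card big_mkcond/=.
rewrite (eq_bigr (fun u => \sum_t (t \in X u : nat)))%N; last first.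
  by move=> u _; rewrite -sum1_card big_mkcond; apply: eq_bigr => t _; case: ifP.
rewrite exchange_big; apply: leq_sum => t _; case: ifP => // /SX[u tu].
by rewrite (bigD1 u)//= tu.
Qed.

Lemma superadditive_measure_ge_entropy (R : realType) (alpha beta : nat -> bool)
    (K : bitstring -> bitstring -> R) :
  superadditive_measure K ->
  exists2 C : R, 0 <= C & forall k N, (0 < k)%N ->
  ((N%:R * (block_entropy R k (N %/ k) alpha beta / k%:R
     - log2 (2 * C * k.+1%:R + 1) / k%:R) - k%:R)%:E <=
   (K (substring alpha 0 N) (substring beta 0 N))%:E)%E.
Proof.
(* The absolute value provides the nonnegative constant that the entropy bound asks for. *)
case=> K0 KD [c Kc]; exists `|c| => //.
pose kappa i n := (K (substring alpha i n) (substring beta i n))%:E.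
apply: (@superadditive_cost_ge_entropy _ alpha beta kappa) => //.
- by move=> i n; rewrite lee_fin K0// !size_substring.
- move=> i m n; rewrite -EFinD lee_fin !substring_cat.
  by apply: KD; rewrite !size_substring.
move=> k B m; have [fX cX] := Kc m%:R B.
apply: (@le_trans _ _ (c * 2 ^+ m)); last by rewrite ler_wpM2r// ler_norm.
rewrite powR_mulrn// in cX; apply: le_trans cX; rewrite ler_nat.
set S := [set _ | _]%SET.
have -> : #|S| = size (map val (enum S)) by rewrite size_map cardE.
apply: uniq_leq_size; first by rewrite map_inj_uniq ?enum_uniq//; exact: val_inj.
move=> _ /mapP[t + ->]; rewrite mem_enum inE => /asboolP[i [tA tB tk]].
rewrite in_fset_set// inE/=; split; first by rewrite !size_tuple.
by rewrite tA tB -lee_fin.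
Qed.

(** * Finite-state a priori complexity *)

Lemma sum_output_prob (M : prob_process) (s : ps_state M) (B : bitstring) :
  \sum_(A : (size B).-tuple bool) output_prob s A B = 1.
Proof.
elim: B s => [|b B IH] s.
  rewrite (big_pred1 [tuple]) => [//|t].
  by apply/esym/eqP; exact: tuple0.
rewrite (@big_tuple_cons _ _ _ (fun A => output_prob s A (b :: B)))/=.
rewrite (eq_bigr (fun a => ps_prob s b a)) => [|a _]; last first.
  by rewrite -mulr_sumr IH mulr1.
by rewrite big_bool/= addrC ps_prob_sum1.
Qed.

Lemma output_prob_ge0 (M : prob_process) (s : ps_state M) (A B : bitstring) :
  0 <= output_prob s A B.
Proof.
by elim: A B s => [|a A IH] [|b B] s //=; rewrite mulr_ge0 ?ps_prob_ge0.
Qed.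

Lemma output_prob_le1 (M : prob_process) (s : ps_state M) (A B : bitstring) :
  output_prob s A B <= 1.
Proof.
elim: A B s => [|a A IH] [|b B] s //=; rewrite mulr_ile1 ?ps_prob_ge0 ?output_prob_ge0//.
rewrite -(ps_prob_sum1 s b); case: a; rewrite ?lerDl ?lerDr ps_prob_ge0//.
Qed.

Lemma output_prob_cat (M : prob_process) (A1 A2 B1 B2 : bitstring) (s : ps_state M) :
  size A1 = size B1 ->
  exists s' : ps_state M, output_prob s (A1 ++ A2) (B1 ++ B2) =
    output_prob s A1 B1 * output_prob s' A2 B2.
Proof.
elim: A1 B1 s => [|a A IH] [|b B] s //=; first by exists s; rewrite mul1r.
by move=> [sAB]; have [s' ->] := IH B (ps_next s b a) sAB; exists s'; rewrite mulrA.
Qed.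

Definition max_output_prob (M : prob_process) (A B : bitstring) : rat :=
  \big[Num.max/0]_(s : ps_state M) output_prob s A B.

Lemma max_output_prob_ge0 (M : prob_process) (A B : bitstring) :
  0 <= max_output_prob M A B.
Proof.
by rewrite /max_output_prob; elim/big_rec: _ => // s x _ x0; rewrite le_max x0 orbT.
Qed.

Lemma max_output_prob_ge (M : prob_process) (s : ps_state M) (A B : bitstring) :
  output_prob s A B <= max_output_prob M A B.
Proof. by rewrite /max_output_prob (bigD1 s)//= le_max lexx. Qed.

Lemma max_output_prob_le (M : prob_process) (A B : bitstring) (x : rat) :
  0 <= x -> (forall s : ps_state M, output_prob s A B <= x) -> max_output_prob M A B <= x.
Proof.
move=> x0 H; rewrite /max_output_prob; elim/big_rec: _ => // s y _ yx.
by rewrite ge_max H.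
Qed.

(** The second string is produced from the state reached after the first one, and the maximum ranges
    over all start states. Taking logarithms gives superadditivity. *)
Lemma max_output_prob_cat (M : prob_process) (A1 A2 B1 B2 : bitstring) :
  size A1 = size B1 ->
  max_output_prob M (A1 ++ A2) (B1 ++ B2) <=
  max_output_prob M A1 B1 * max_output_prob M A2 B2.
Proof.
move=> sAB; apply: max_output_prob_le; first by rewrite mulr_ge0 ?max_output_prob_ge0.
move=> s; have [s' ->] := output_prob_cat A2 B2 s sAB.
by rewrite ler_pM ?output_prob_ge0 ?max_output_prob_ge.
Qed.

Lemma log2e_EFin (R : realType) (x : R) : 0 < x -> log2e x = (log2 x)%:E.
Proof.
by move=> x0; rewrite /log2e lne_EFin// inver gt_eqF ?ln2_gt0// -EFinM.
Qed.

Lemma log2e_0 (R : realType) : log2e (0 : R) = -oo%E.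
Proof.
by rewrite /log2e le0_lneNy// inver gt_eqF ?ln2_gt0// gt0_mulNye// lte_fin invr_gt0 ln2_gt0.
Qed.

Lemma le_log2e (R : realType) (x y : R) : 0 <= x -> x <= y -> (log2e x <= log2e y)%E.
Proof.
rewrite le_eqVlt => /orP[/eqP<- _|x0 xy]; first by rewrite log2e_0 leNye.
by rewrite !log2e_EFin// ?(lt_le_trans x0)// lee_fin ler_log2.
Qed.

Lemma apriori_complexity_ge0 (R : realType) (M : prob_process) (A B : bitstring) :
  (0 <= apriori_complexity R M A B)%E.
Proof.
rewrite oppe_ge0 -(_ : log2e 1 = 0%E :> \bar R); last by rewrite log2e_EFin// log2_1.
apply: le_log2e; first by rewrite ler0q max_output_prob_ge0.
rewrite -[X in _ <= X](rmorph1 (@ratr R)) ler_rat max_output_prob_le// => s.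
exact: output_prob_le1.
Qed.

Lemma apriori_complexity_superadditive (R : realType) (M : prob_process)
    (A1 A2 B1 B2 : bitstring) : size A1 = size B1 ->
  (apriori_complexity R M A1 B1 + apriori_complexity R M A2 B2 <=
   apriori_complexity R M (A1 ++ A2) (B1 ++ B2))%E.
Proof.
move=> sAB; have := @max_output_prob_cat M _ A2 _ B2 sAB.
rewrite /apriori_complexity -!/(max_output_prob M _ _).
have := max_output_prob_ge0 M A1 B1; have := max_output_prob_ge0 M A2 B2.
have := max_output_prob_ge0 M (A1 ++ A2) (B1 ++ B2).
move: (max_output_prob M _ _) (max_output_prob M _ _) (max_output_prob M _ _) => z y x.
rewrite le0r => /orP[/eqP-> _ _ _|z0]; first by rewrite rmorph0 log2e_0 leey.
rewrite le0r => /orP[/eqP->|x0]; first by move=> _; rewrite mulr0 leNgt z0.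
rewrite le0r => /orP[/eqP->|y0]; first by rewrite mul0r leNgt z0.
move=> zxy.
rewrite !log2e_EFin ?ltr0q// -!EFinN -EFinD lee_fin -opprD lerN2.
by rewrite -log2M ?ltr0q// ler_log2 ?ltr0q// -rmorphM ler_rat.
Qed.

(** Each counted string has probability at least [2 ^- m] from some state, and the probabilities
    from all states together sum to the number of states. *)
Lemma card_apriori_complexity_le (R : realType) (M : prob_process) k
    (B : k.-tuple bool) (m : nat) :
  #|[set A : k.-tuple bool | (apriori_complexity R M A B <= m%:R%:E)%E]%SET|%:R
    <= #|ps_state M|%:R * 2 ^+ m :> R.
Proof.
set X := [set _ | _]%SET.
have XP A : A \in X -> 2 ^- m <= \sum_(s : ps_state M) output_prob s A B :> rat.
  rewrite inE /apriori_complexity -/(max_output_prob M _ _) => H.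
  apply: (@le_trans _ _ (max_output_prob M A B)); last first.
    apply: max_output_prob_le; first by rewrite sumr_ge0// => s _; exact: output_prob_ge0.
    by move=> s; rewrite (bigD1 s)//= lerDl sumr_ge0// => s' _; exact: output_prob_ge0.
  rewrite leNgt; apply/negP => lt2; move: H; apply/negP; rewrite -ltNge.
  have := max_output_prob_ge0 M A B; rewrite le_eqVlt => /orP[/eqP<-|p0].
    by rewrite rmorph0 log2e_0 ltey.
  rewrite log2e_EFin ?ltr0q// -EFinN lte_fin ltrNr -[X in - X](log2_pow2 R).
  rewrite -log2V ?exprn_gt0// /log2 ltr_pM2r ?invr_gt0 ?ln2_gt0//.
  rewrite ltr_ln ?posrE ?ltr0q ?invr_gt0 ?exprn_gt0//.
  have -> : 2 ^- m = ratr (2 ^- m) :> R by rewrite fmorphV rmorphXn rmorph_nat.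
  by rewrite ltr_rat.
have : \sum_(A in X) (2 ^- m : rat) <= #|ps_state M|%:R.
  apply: (@le_trans _ _ (\sum_(A : k.-tuple bool) \sum_(s : ps_state M) output_prob s A B)).
    rewrite big_mkcond/=; apply: ler_sum => A _; case: ifP => [/XP//|_].
    by rewrite sumr_ge0// => s _; exact: output_prob_ge0.
  rewrite exchange_big/= (eq_bigr (fun=> 1)) ?sumr_const// => s _.
  by rewrite -(sum_output_prob s B) size_tuple.
rewrite sumr_const -[_ *+ _]mulr_natl ler_pdivrMr ?exprn_gt0// => H.
by rewrite -natrX -natrM ler_nat -(ler_nat rat) natrM natrX.
Qed.

(** The shifted condition of a block is obtained from its own condition block [B] and the next [c]
    bits [u], by dropping the first [c] bits of [B ++ u]. The union over all [u] costs the factor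
    [2 ^+ c]. *)
Lemma apriori_complexity_ge_entropy (R : realType) (alpha beta : nat -> bool)
    (M : prob_process) (c : nat) :
  exists2 C : R, 0 <= C & forall k N, (0 < k)%N ->
  ((N%:R * (block_entropy R k (N %/ k) alpha beta / k%:R
     - log2 (2 * C * k.+1%:R + 1) / k%:R) - k%:R)%:E <=
   apriori_complexity R M (substring alpha 0 N) (substring beta c N))%E.
Proof.
exists (2 ^+ c * #|ps_state M|%:R); first by rewrite mulr_ge0// exprn_ge0.
pose kappa i n := apriori_complexity R M (substring alpha i n) (substring beta (c + i) n).
move=> k N k0; rewrite -[X in substring beta X N]addn0 -/(kappa 0%N N).
apply: (@superadditive_cost_ge_entropy _ alpha beta kappa) => //.
- by move=> i n; exact: apriori_complexity_ge0.
- move=> i m n; rewrite /kappa !substring_cat addnA.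
  by apply: apriori_complexity_superadditive; rewrite !size_substring.
move=> {k N k0} k B m.
have szB (u : c.-tuple bool) : size (drop c (B ++ u)) == k.
  by rewrite size_drop size_cat !size_tuple addnK.
pose Bu u : k.-tuple bool := Tuple (szB u).
pose X (u : c.-tuple bool) :=
  [set A : k.-tuple bool | (apriori_complexity R M A (Bu u) <= m%:R%:E)%E]%SET.
apply: (@le_trans _ _ (\sum_(u : c.-tuple bool) #|X u|)%:R).
  rewrite ler_nat; apply: card_le_sum => A; rewrite inE => /asboolP[i [AE BE Hk]].
  exists [tuple of substring beta (i + k) c]; rewrite inE/= BE -substring_cat.
  rewrite addnC substring_cat drop_size_cat ?size_substring//.
  by rewrite AE addnC.
rewrite natr_sum; apply: (@le_trans _ _ (\sum_(u : c.-tuple bool) #|ps_state M|%:R * 2 ^+ m)).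
  by apply: ler_sum => u _; exact: card_apriori_complexity_le.
by rewrite sumr_const card_tuple card_bool -[_ *+ _]mulr_natl natrX mulrA.
Qed.

(** * Gambling strategies as probabilistic processes *)

Definition window (c : nat) (beta : nat -> bool) (i : nat) : c.+1.-tuple bool :=
  [tuple beta (i + j)%N | j < c.+1].

Lemma tval_window c beta i : tval (window c beta i) = substring beta i c.+1.
Proof.
apply: (@eq_from_nth _ false); first by rewrite size_tuple size_mkseq.
move=> j; rewrite size_tuple => jk; rewrite nth_mkseq//.
by rewrite -[j]/(nat_of_ord (Ordinal jk)) -tnth_nth tnth_mktuple.
Qed.

Lemma substring_cons (alpha : nat -> bool) i n :
  substring alpha i n.+1 = alpha i :: substring alpha i.+1 n.
Proof.
rewrite -[n.+1]add1n substring_cat addn1; congr (_ :: _).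
by rewrite addn0.
Qed.

Lemma oracle_window_substring (c : nat) (beta : nat -> bool) (i n : nat) : (c < n)%N ->
  oracle_window c (substring beta i n) = window c beta i.
Proof.
move=> cn; apply/eq_from_tnth => j; rewrite !tnth_mktuple nth_mkseq//.
by rewrite (leq_trans (ltn_ord j)).
Qed.

(** The capital without the doublings, read directly off the infinite sequences from position
    [i]. *)
Fixpoint bet_product (G : gambling_strategy) (alpha beta : nat -> bool)
    (s : gs_state G) (l : bool) (i n : nat) : rat :=
  if n is n'.+1 then
    let w := window (gs_lookahead G) beta i in
    gs_bet s l w (alpha i) *
      bet_product alpha beta (gs_next s l w) (alpha i) i.+1 n'
  else 1.

Lemma capital_from_bet_product (G : gambling_strategy) (alpha beta : nat -> bool)
    (s : gs_state G) (l : bool) (i n : nat) :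
  capital_from s l (substring alpha i n) (substring beta i (n + gs_lookahead G)) =
  2 ^+ n * bet_product alpha beta s l i n.
Proof.
elim: n s l i => [|n IH] s l i; first by rewrite expr0 mul1r.
rewrite addSn; set B := substring beta i _.
have wB : oracle_window (gs_lookahead G) B = window (gs_lookahead G) beta i.
  by rewrite oracle_window_substring// ltnS leq_addl.
have bB : behead B = substring beta i.+1 (n + gs_lookahead G).
  by rewrite /B substring_cons.
by rewrite substring_cons; clearbody B; rewrite /= wB bB IH exprS; ring.
Qed.

Lemma bet_product_ge0 (G : gambling_strategy) (alpha beta : nat -> bool)
    (s : gs_state G) (l : bool) (i n : nat) :
  0 <= bet_product alpha beta s l i n.
Proof. by elim: n s l i => //= n IH s l i; rewrite mulr_ge0 ?gs_bet_ge0. Qed.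

Lemma bet_product_add (G : gambling_strategy) (alpha beta : nat -> bool)
    (s : gs_state G) (l : bool) (i m n : nat) :
  bet_product alpha beta s l i (m + n) <= bet_product alpha beta s l i m.
Proof.
elim: m s l i => [|m IH] s l i; last by rewrite addSn/= ler_wpM2l ?gs_bet_ge0.
rewrite add0n /=; elim: n s l i => //= n IH s l i.
rewrite mulr_ile1 ?gs_bet_ge0 ?bet_product_ge0//.
by rewrite -(gs_bet_sum1 s l (window (gs_lookahead G) beta i)); case: (alpha i);
  rewrite ?lerDl ?lerDr gs_bet_ge0.
Qed.

(* The process reads the bit [b_(i+c)] and keeps the last observed bit and the
   window [b_i ... b_(i+c-1)] in its state. *)
Definition strategy_state (G : gambling_strategy) : finType :=
  (gs_state G * bool * (gs_lookahead G).-tuple bool)%type.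

Definition strategy_next (G : gambling_strategy) (s : strategy_state G)
    (b a : bool) : strategy_state G :=
  let w := [tuple of rcons s.2 b] in
  (gs_next s.1.1 s.1.2 w, a, [tuple of behead w]).

Definition strategy_prob (G : gambling_strategy) (s : strategy_state G)
    (b a : bool) : rat :=
  gs_bet s.1.1 s.1.2 [tuple of rcons s.2 b] a.

Lemma strategy_prob_ge0 (G : gambling_strategy) (s : strategy_state G) b a :
  0 <= strategy_prob s b a.
Proof. exact: gs_bet_ge0. Qed.

Lemma strategy_prob_sum1 (G : gambling_strategy) (s : strategy_state G) b :
  strategy_prob s b false + strategy_prob s b true = 1.
Proof. exact: gs_bet_sum1. Qed.

Definition strategy_process (G : gambling_strategy) : prob_process :=
  ProbProcess (@strategy_next G) (@strategy_prob_ge0 G) (@strategy_prob_sum1 G).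

(** The stored bits and the newly read bit always make up the window seen by the strategy, so each
    transition probability is the fraction bet on the emitted bit. *)
Lemma output_prob_strategy_process (G : gambling_strategy) (alpha beta : nat -> bool)
    (s : gs_state G) (l : bool) (u : (gs_lookahead G).-tuple bool) (i n : nat) :
  tval u = substring beta i (gs_lookahead G) ->
  @output_prob (strategy_process G) (s, l, u)
    (substring alpha i n) (substring beta (gs_lookahead G + i) n)
  = bet_product alpha beta s l i n.
Proof.
elim: n s l u i => [//|n IH] s l u i uE.
have rE : rcons u (beta (gs_lookahead G + i)%N) = substring beta i (gs_lookahead G).+1.
  by rewrite uE -[(gs_lookahead G).+1]addn1 substring_cat -cats1 addnC substring_cons.
have wE : [tuple of rcons u (beta (gs_lookahead G + i)%N)] = window (gs_lookahead G) beta i.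
  by apply/val_inj; rewrite /= rE tval_window.
rewrite !substring_cons /= /strategy_prob/= wE; congr (_ * _).
have -> : strategy_next (s, l, u) (beta (gs_lookahead G + i)%N) (alpha i) =
    (gs_next s l (window (gs_lookahead G) beta i), alpha i,
     [tuple of behead (window (gs_lookahead G) beta i)]) by rewrite -wE.
by rewrite -addnS; apply: IH; rewrite /= tval_window substring_cons.
Qed.

(** The maximum over start states includes the one that already stores the first [gs_lookahead G]
    bits of [beta]. A ruined gambler has infinite cost. *)
Lemma apriori_complexity_le_capital (R : realType) (G : gambling_strategy)
    (alpha beta : nat -> bool) (N : nat) :
  (apriori_complexity R (strategy_process G) (substring alpha 0 N)
     (substring beta (gs_lookahead G) N) <=
   N%:R%:E - log2e (ratr (capital G (substring alpha 0 N)
     (substring beta 0 (N + gs_lookahead G)))))%E.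
Proof.
rewrite /capital capital_from_bet_product.
set p := bet_product _ _ _ _ _ _.
have : p <= max_output_prob (strategy_process G) (substring alpha 0 N)
     (substring beta (gs_lookahead G) N).
  have -> : substring beta (gs_lookahead G) N = substring beta (gs_lookahead G + 0) N.
    by rewrite addn0.
  by rewrite /p -(@output_prob_strategy_process G alpha beta _ _
    [tuple of substring beta 0 (gs_lookahead G)])// max_output_prob_ge.
have : 0 <= p by exact: bet_product_ge0.
rewrite /apriori_complexity -/(max_output_prob _ _ _).
rewrite le0r => /orP[/eqP-> _|p0 pm]; first by rewrite mulr0 rmorph0 log2e_0 leey.
rewrite !log2e_EFin ?ltr0q ?mulr_gt0 ?exprn_gt0//; last exact: lt_le_trans pm.
rewrite -EFinN -EFinB lee_fin rmorphM rmorphXn rmorph_nat.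
have pR : 0 < ratr p :> R by rewrite ltr0q.
rewrite (log2M (exprn_gt0 N (ltr0n R 2)) pR) log2_pow2 opprD addNKr lerN2 ler_log2 ?ltr0q//.
by rewrite ler_rat.
Qed.

(** * Automatic description modes *)

Lemma is_walk_cat (Gamma : labeled_graph) (v : lg_vertex Gamma) (w1 w2 : seq (lg_edge Gamma)) :
  is_walk v (w1 ++ w2) = is_walk v w1 && is_walk (last v (map (@lg_dst Gamma) w1)) w2.
Proof. by elim: w1 v => //= e w1 IH v; rewrite IH andbA. Qed.

Lemma pmap_omap (S T U : Type) (f : S -> option T) (g : T -> U) (w : seq S) :
  pmap (fun e => omap g (f e)) w = map g (pmap f w).
Proof. by elim: w => //= e w ->; case: (f e). Qed.

Lemma pmap_eq_cat (S T : Type) (f : S -> option T) (w : seq S) (X1 X2 : seq T) :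
  pmap f w = X1 ++ X2 ->
  exists w1 w2, [/\ w = w1 ++ w2, pmap f w1 = X1 & pmap f w2 = X2].
Proof.
elim: w X1 => [|e w IH] X1 /=.
  by case: X1 => //= <-; exists [::], [::].
case E : (f e) => [x|] /=; last first.
  by move=> /IH[w1 [w2 [-> <- <-]]]; exists (e :: w1), w2; rewrite /= E.
case: X1 => [|x1 X1] /=; first by move=> <-; exists [::], (e :: w); rewrite /= E.
by move=> [<- /IH[w1 [w2 [-> <- <-]]]]; exists (e :: w1), w2; rewrite /= E.
Qed.

(** Both strings are projections of one sequence of pairs, so that one cut of the walk serves
    both. *)
Lemma describes_io (Gamma : labeled_graph) (A B P : bitstring) :
  describes Gamma A B P <-> exists v w, [/\ is_walk v w,
    A = map fst (pmap (@lg_io Gamma) w), B = map snd (pmap (@lg_io Gamma) w) &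
    P = pmap (@lg_descr Gamma) w].
Proof.
by split=> -[v [w [vw AE BE PE]]]; exists v, w; split => //;
  rewrite ?AE ?BE ?pmap_omap.
Qed.

(** The walk is cut where the first [size A1] pairs have been read. Both pieces are again admissible
    because walks may start and end anywhere. *)
Lemma describes_cat (Gamma : labeled_graph) (A1 A2 B1 B2 P : bitstring) :
  size A1 = size B1 -> describes Gamma (A1 ++ A2) (B1 ++ B2) P ->
  exists P1 P2, [/\ P = P1 ++ P2, describes Gamma A1 B1 P1 & describes Gamma A2 B2 P2].
Proof.
move=> sAB /describes_io[v [w [vw AE BE ->]]].
set X := pmap _ w in AE BE.
have [w1 [w2 [wE X1 X2]]] := pmap_eq_cat (esym (cat_take_drop (size A1) X)).
move: vw; rewrite wE is_walk_cat => /andP[vw1 vw2].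
exists (pmap (@lg_descr Gamma) w1), (pmap (@lg_descr Gamma) w2); rewrite pmap_cat.
split => //; apply/describes_io.
  exists v, w1; split => //; rewrite X1 map_take.
    by rewrite -AE take_size_cat.
  by rewrite -BE take_size_cat.
eexists; exists w2; split; [exact: vw2| | |by []]; rewrite X2 map_drop.
  by rewrite -AE drop_size_cat.
by rewrite -BE drop_size_cat.
Qed.

Lemma automatic_complexity_ge0 (R : realType) (Gamma : labeled_graph) (A B : bitstring) :
  (0 <= automatic_complexity R Gamma A B)%E.
Proof. by apply: le_ereal_inf_tmp => _ [P _ <-]; rewrite lee_fin. Qed.

Lemma automatic_complexity_le (R : realType) (Gamma : labeled_graph) (A B P : bitstring) :
  describes Gamma A B P -> (automatic_complexity R Gamma A B <= (size P)%:R%:E)%E.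
Proof. by move=> H; apply: ereal_inf_lbound; exists P. Qed.

(** Lengths are integers: if every description were longer than the integer part of [m], the infimum
    would exceed [m]. *)
Lemma automatic_complexity_leP (R : realType) (Gamma : labeled_graph) (A B : bitstring) (m : R) :
  (automatic_complexity R Gamma A B <= m%:E)%E ->
  exists2 P, describes Gamma A B P & (size P <= Num.truncn m)%N.
Proof.
move=> Cm.
have m0 : 0 <= m by rewrite -lee_fin (le_trans _ Cm)// automatic_complexity_ge0.
apply/not_exists2P => H; move: Cm; apply/negP; rewrite -ltNge.
apply: (@lt_le_trans _ _ (Num.truncn m).+1%:R%:E); first by rewrite lte_fin truncnS_gt.
apply: le_ereal_inf_tmp => _ [P PD <-]; rewrite lee_fin ler_nat.
by have [//|/negP] := H P; rewrite -ltnNge.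
Qed.

Lemma automatic_complexity_superadditive (R : realType) (Gamma : labeled_graph)
    (A1 A2 B1 B2 : bitstring) : size A1 = size B1 ->
  (automatic_complexity R Gamma A1 B1 + automatic_complexity R Gamma A2 B2 <=
   automatic_complexity R Gamma (A1 ++ A2) (B1 ++ B2))%E.
Proof.
move=> sAB; apply: le_ereal_inf_tmp => _ [P /(describes_cat sAB)[P1 [P2 [-> D1 D2]]] <-].
by rewrite size_cat natrD EFinD leeD// automatic_complexity_le.
Qed.

Lemma card_tuple_le_fset k (S : {set k.-tuple bool}) (X : set bitstring) :
  finite_set X -> (forall A, A \in S -> X (val A)) -> (#|S| <= #|` fset_set X|)%N.
Proof.
move=> fX SX; have -> : #|S| = size (map val (enum S)) by rewrite size_map cardE.
apply: uniq_leq_size; first by rewrite map_inj_uniq ?enum_uniq//; exact: val_inj.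
move=> _ /mapP[t + ->]; rewrite mem_enum => /SX Xt.
by rewrite in_fset_set// inE.
Qed.

(** There are fewer than [2 * 2 ^ m] descriptions of length at most [m], each describing at most [c]
    strings for the given condition. *)
Lemma card_described_le (Gamma : labeled_graph) (c : nat) :
  (forall B P, ([set A | describes Gamma A B P] #<= `I_c)%card) ->
  forall k (B : bitstring) (m : nat),
  (#|[set A : k.-tuple bool |
     `[< exists2 P, describes Gamma A B P & (size P <= m)%N >]]%SET| <= 2 * c * 2 ^ m)%N.
Proof.
move=> Hc k B m.
pose X (j : 'I_m.+1) :=
  [set A : k.-tuple bool | `[< exists P : j.-tuple bool, describes Gamma A B P >]]%SET.
have XS (j : 'I_m.+1) : (#|X j| <= 2 ^ j * c)%N.
  pose Y (P : j.-tuple bool) := [set A : k.-tuple bool | `[< describes Gamma A B P >]]%SET.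
  apply: (@leq_trans (\sum_P #|Y P|)).
    apply: card_le_sum => A; rewrite inE => /asboolP[P D].
    by exists P; rewrite inE; apply/asboolP.
  rewrite -[X in (_ <= X * _)%N](_ : #|{: j.-tuple bool}| = _); last first.
    by rewrite card_tuple card_bool.
  rewrite -sum_nat_const; apply: leq_sum => P _.
  have := Hc B P => HcP.
  apply: leq_trans (geq_card_fset_set HcP).
  apply: card_tuple_le_fset; first exact: card_le_finite HcP (finite_II c).
  by move=> A; rewrite inE => /asboolP.
apply: (@leq_trans (\sum_j #|X j|)).
  apply: card_le_sum => A; rewrite inE => /asboolP[P D Pm].
  have Pm' : (size P < m.+1)%N by [].
  by exists (Ordinal Pm'); rewrite inE; apply/asboolP; exists (in_tuple P).
apply: (@leq_trans (\sum_(j < m.+1) 2 ^ j * c)); first exact: leq_sum.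
rewrite -big_distrl/= mulnAC leq_mul2r; apply/orP; right.
elim: (m) => [|n IH]; first by rewrite big_ord_recr big_ord0.
rewrite big_ord_recr/=; apply: (leq_trans (leq_add IH (leqnn _))).
by rewrite -expnS addnn -mul2n.
Qed.

Lemma automatic_complexity_ge_entropy (R : realType) (alpha beta : nat -> bool)
    (Gamma : labeled_graph) :
  description_mode Gamma ->
  exists2 C : R, 0 <= C & forall k N, (0 < k)%N ->
  ((N%:R * (block_entropy R k (N %/ k) alpha beta / k%:R
     - log2 (2 * C * k.+1%:R + 1) / k%:R) - k%:R)%:E <=
   automatic_complexity R Gamma (substring alpha 0 N) (substring beta 0 N))%E.
Proof.
case=> c Hc; exists (2 * c%:R); first by rewrite mulr_ge0.
pose kappa i n := automatic_complexity R Gamma (substring alpha i n) (substring beta i n).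
apply: (@superadditive_cost_ge_entropy _ alpha beta kappa) => //.
- by move=> i n; exact: automatic_complexity_ge0.
- move=> i m n; rewrite /kappa !substring_cat.
  by apply: automatic_complexity_superadditive; rewrite !size_substring.
move=> k B m; have := card_described_le Hc k B m.
rewrite -(ler_nat R) !natrM natrX; apply: le_trans; rewrite ler_nat subset_leq_card//.
apply/fintype.subsetP => A; rewrite inE => /asboolP[i [AE BE H]].
rewrite inE; apply/asboolP.
by have := automatic_complexity_leP H; rewrite natrK -AE -BE.
Qed.

(** Totality makes the complexity finite on strings of equal length, so [fine] preserves it
    there. *)
Lemma superadditive_measure_automatic (R : realType) (Gamma : labeled_graph) :
  description_mode Gamma ->
  (forall A B, size A = size B -> exists P, describes Gamma A B P) ->
  superadditive_measure (fun A B => fine (automatic_complexity R Gamma A B)).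
Proof.
move=> [c Hc] tot.
have fin A B : size A = size B -> automatic_complexity R Gamma A B \is a fin_num.
  move=> /tot[P /(automatic_complexity_le R) CP].
  rewrite fin_numE -ltey -ltNye (le_lt_trans CP (ltry _)).
  by rewrite (lt_le_trans (ltNyr 0) (automatic_complexity_ge0 _ _ _ _)).
split.
- by move=> A B AB; rewrite fine_ge0// automatic_complexity_ge0.
- move=> A1 A2 B1 B2 AB1 AB2; rewrite -lee_fin EFinD !fineK ?fin//.
    exact: automatic_complexity_superadditive.
  by rewrite !size_cat AB1 AB2.
exists (2 * c%:R) => m B; pose S := [set A : (size B).-tuple bool |
  `[< exists2 P, describes Gamma A B P & (size P <= Num.truncn m)%N >]]%SET.
set X := [set A | _].
have XS : X `<=` [set` map val (enum S)].
  move=> A [AB]; rewrite -lee_fin fineK ?fin// => /automatic_complexity_leP H.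
  have sA : size A == size B by rewrite AB.
  apply/mapP; exists (Tuple sA) => //; rewrite mem_enum inE; exact/asboolP.
have fX : finite_set X by apply: sub_finite_set XS _; exact: finite_seq.
split => //.
(* For negative [m] the integer part is [0] and the count by descriptions would be too weak, but no
   complexity is negative. *)
have [m0|m0] := ltP m 0.
  rewrite (_ : X = set0) ?fset_set0 ?cardfs0 ?mulr_ge0 ?powR_ge0//.
  apply/seteqP; split => // A [AB]; apply/negP; rewrite -ltNge.
  by apply: lt_le_trans m0 _; rewrite fine_ge0// automatic_complexity_ge0.
apply: (@le_trans _ _ #|S|%:R).
  rewrite ler_nat cardE -(size_map val) uniq_leq_size// => A.
  by rewrite in_fset_set// inE => /XS.
apply: (@le_trans _ _ (2 * c%:R * 2 ^+ Num.truncn m)).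
  have := card_described_le Hc (size B) B (Num.truncn m).
  by rewrite -(ler_nat R) !natrM natrX.
rewrite ler_wpM2l ?mulr_ge0// -powR_mulrn// ler_powR ?ler1n// truncn_le//.
Qed.

(** * Mixtures of bit predictors *)

(* [mu B p] is the probability that a random string, generated with condition
   [B], starts with [p]. *)
Record conditional_measure (mu : bitstring -> bitstring -> rat) : Prop :=
  ConditionalMeasure {
    cm_nil : forall B, mu B [::] = 1;
    cm_gt0 : forall B p, 0 < mu B p;
    cm_rcons : forall B p, mu B (rcons p false) + mu B (rcons p true) = mu B p
  }.

Lemma sum_conditional_measure (mu : bitstring -> bitstring -> rat) :
  conditional_measure mu ->
  forall n B p, \sum_(A : n.-tuple bool) mu B (p ++ A) = mu B p.
Proof.
move=> Hmu; elim=> [|n IH] B p.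
  rewrite (big_pred1 [tuple]) ?cats0 => [//|t].
  by apply/esym/eqP; exact: tuple0.
rewrite (@big_tuple_cons _ _ _ (fun A => mu B (p ++ A)))/= big_bool/=.
rewrite -(cm_rcons Hmu) addrC; congr (_ + _); rewrite -[in RHS]IH;
  by apply: eq_bigr => A _; rewrite cat_rcons.
Qed.

(* A predictor [r] gives the probability of the next bit when the condition is
   [B] and the bits [p] have been produced. *)
Fixpoint prediction (r : bitstring -> bitstring -> bool -> rat)
    (B p A : bitstring) : rat :=
  if A is a :: A' then r B p a * prediction r B (rcons p a) A' else 1.

Lemma prediction_rcons r B p A a :
  prediction r B p (rcons A a) = prediction r B p A * r B (p ++ A) a.
Proof.
elim: A p => [|x A IH] p /=; first by rewrite cats0 mulr1 mul1r.
by rewrite IH cat_rcons mulrA.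
Qed.

Lemma prediction_gt0 r B p A : (forall p a, 0 < r B p a) -> 0 < prediction r B p A.
Proof. by move=> r0; elim: A p => //= a A IH p; rewrite mulr_gt0. Qed.

Definition mixture (U : finType) (r : U -> bitstring -> bitstring -> bool -> rat)
    (B p : bitstring) : rat :=
  (\sum_u prediction (r u) B [::] p) / #|U|%:R.

Lemma mixture_conditional_measure (U : finType)
    (r : U -> bitstring -> bitstring -> bool -> rat) : (0 < #|U|)%N ->
  (forall u B p a, 0 < r u B p a) ->
  (forall u B p, r u B p false + r u B p true = 1) ->
  conditional_measure (mixture r).
Proof.
move=> U0 r0 r1; split.
- by move=> B; rewrite /mixture /= sumr_const divff// pnatr_eq0 -lt0n.
- move=> B p; rewrite divr_gt0 ?ltr0n//; have /card_gt0P[u _] := U0.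
  rewrite (bigD1 u)//= ltr_wpDr// ?prediction_gt0// sumr_ge0// => v _.
  by rewrite ltW// prediction_gt0.
- move=> B p; rewrite /mixture -mulrDl -big_split/=; congr (_ / _).
  by apply: eq_bigr => u _; rewrite !prediction_rcons -mulrDr r1 mulr1.
Qed.

(** The mixture is worse than its best component by at most [log2 #|U|] bits, even if that component
    is identified only afterwards. *)
Lemma mixture_ge (U : finType) (r : U -> bitstring -> bitstring -> bool -> rat) B p u :
  (forall u B p a, 0 < r u B p a) ->
  prediction (r u) B [::] p / #|U|%:R <= mixture r B p.
Proof.
move=> r0; rewrite /mixture ler_wpM2r// (bigD1 u)//= lerDl sumr_ge0// => v _.
by rewrite ltW// prediction_gt0.
Qed.

Lemma take_substring (alpha : nat -> bool) i m n : (m <= n)%N ->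
  take m (substring alpha i n) = substring alpha i m.
Proof.
by move=> mn; rewrite -(subnKC mn) substring_cat take_size_cat// size_substring.
Qed.

Lemma drop_substring (alpha : nat -> bool) i m n : (m <= n)%N ->
  drop m (substring alpha i n) = substring alpha (i + m) (n - m).
Proof.
by move=> mn; rewrite -{1}(subnKC mn) substring_cat drop_size_cat// size_substring.
Qed.

Lemma substring_rcons (alpha : nat -> bool) i n :
  substring alpha i n.+1 = rcons (substring alpha i n) (alpha (i + n)%N).
Proof. by rewrite -addn1 substring_cat -cats1 substring_cons. Qed.

(* Predictors for blocks of length [k]: the numbers [u], bounded by [T], are
   approximate frequencies of the next bit. *)
Definition table (k T : nat) : finType :=
  {ffun k.-bseq bool * k.-bseq bool * bool -> 'I_T.+1}.

Definition table_value (k T : nat) (u : table k T) (b p : bitstring) (x : bool) : nat :=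
  u (insub_bseq k b, insub_bseq k p, x).

(** Adding one to both frequencies keeps all probabilities away from zero, which bounds the cost of
    a single bit. *)
Definition table_predictor (k T : nat) (u : table k T) (b p : bitstring) (x : bool) : rat :=
  (table_value u b p x).+1%:R /
  ((table_value u b p false).+1 + (table_value u b p true).+1)%:R.

Lemma table_predictor_gt0 k T (u : table k T) b p x : 0 < table_predictor u b p x.
Proof. by rewrite divr_gt0 ?ltr0n. Qed.

Lemma table_predictor_sum1 k T (u : table k T) b p :
  table_predictor u b p false + table_predictor u b p true = 1.
Proof. by rewrite -mulrDl -natrD divff// pnatr_eq0. Qed.

Lemma table_predictor_ge k T (u : table k T) b p x :
  (2 * T.+1)%:R^-1 <= table_predictor u b p x.
Proof.
rewrite -[leLHS]mul1r ler_pM ?invr_ge0 ?ler1n//.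
rewrite lef_pV2 ?posrE ?ltr0n// ler_nat mul2n -addnn.
by rewrite leq_add// /table_value ltn_ord.
Qed.

(** Here [m] is the start of the current short block inside the long one; the table sees only that
    block. *)
Definition long_predictor (k T : nat) (u : table k T) (B p : bitstring) (x : bool) : rat :=
  let m := (size p %/ k * k)%N in
  table_predictor u (take k (drop m B)) (drop m p) x.

Definition bit_prob (k T : nat) (alpha beta : nat -> bool) (u : table k T) (i : nat) : rat :=
  table_predictor u (substring beta (i %/ k * k) k)
    (substring alpha (i %/ k * k) (i %% k)) (alpha i).

(** As [k] divides [i] and [L], the short blocks of the long block are aligned with those of the
    whole sequence. The general start [t] serves the induction. *)
Lemma prediction_long_block (k T : nat) (alpha beta : nat -> bool) (u : table k T)
    (i L s t : nat) : (0 < k)%N -> (k %| i)%N -> (k %| L)%N -> (t + s <= L)%N ->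
  prediction (long_predictor u) (substring beta i L) (substring alpha i t)
    (substring alpha (i + t) s) = \prod_(j < s) bit_prob alpha beta u (i + t + j).
Proof.
move=> k0 ki kL; elim: s t => [|s IH] t tsL; first by rewrite big_ord0.
rewrite substring_cons/= -substring_rcons -addnS (IH t.+1) ?addSnnS//.
rewrite big_ord_recl/= addn0; congr (_ * _); last first.
  by apply: eq_bigr => j _; rewrite /bump/= add1n addnS addSnnS.
rewrite /long_predictor /bit_prob size_substring.
have tL : (t < L)%N by rewrite (leq_trans _ tsL)// -addSnnS leq_addr.
have tk : (t %/ k * k + k <= L)%N.
  by rewrite -mulSnr -leq_divRL// ltn_divLR// divnK.
have ik : ((i + t) %/ k * k = i + t %/ k * k)%N.
  by rewrite divnDl// mulnDl divnK.
have im : ((i + t) %% k = t - t %/ k * k)%N.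
  by rewrite -modnDml (eqP ki) add0n {2}(divn_eq t k) addKn.
rewrite drop_substring; last by rewrite (leq_trans _ tk)// leq_addr.
rewrite take_substring; last by rewrite leq_subRL// (leq_trans _ tk)// leq_addr.
by rewrite drop_substring ?leq_trunc_div// ik im.
Qed.

(** * Empirical frequencies as a predictor *)

Definition occurrences (k n : nat) (alpha beta : nat -> bool) (b p : bitstring) : nat :=
  #|[set i : 'I_n | (substring beta (i * k) k == b) &&
                    (substring alpha (i * k) (size p) == p)]%SET|.

Lemma occurrences_rcons k n alpha beta b p :
  (occurrences k n alpha beta b (rcons p false) +
   occurrences k n alpha beta b (rcons p true))%N = occurrences k n alpha beta b p.
Proof.
rewrite /occurrences -cardsUI [X in (_ + X)%N](_ : _ = 0)%N ?addn0.
  apply: eq_card => i; rewrite !inE !size_rcons !substring_rcons !eqseq_rcons.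
  by case: (alpha _); case: (_ == b); case: (_ == p).
apply: eq_card0 => i; rewrite !inE !size_rcons !substring_rcons !eqseq_rcons.
by case: (alpha _); rewrite /= ?andbF.
Qed.

(** Empirical conditional frequencies of the next bit, in units of [1/T] and rounded down. The
    quotients are at most [T], so [inord] preserves them. *)
Definition frequency_table (k T n : nat) (alpha beta : nat -> bool) : table k T :=
  [ffun z : k.-bseq bool * k.-bseq bool * bool =>
    inord (T * occurrences k n alpha beta z.1.1 (rcons z.1.2 z.2)
           %/ occurrences k n alpha beta z.1.1 z.1.2)].

Lemma occurrences_rcons_le k n alpha beta b p x :
  (occurrences k n alpha beta b (rcons p x) <= occurrences k n alpha beta b p)%N.
Proof.
by rewrite -(occurrences_rcons k n alpha beta b p); case: x; rewrite ?leq_addl ?leq_addr.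
Qed.

Lemma insub_bseqE (T : Type) n (s : seq T) : (size s <= n)%N ->
  insub_bseq n s = s :> seq T.
Proof. by move=> sn; rewrite /insub_bseq insubdK. Qed.

Lemma frequency_tableE (k T n : nat) (alpha beta : nat -> bool) b p x :
  (size b <= k)%N -> (size p <= k)%N ->
  table_value (frequency_table k T n alpha beta) b p x =
  (T * occurrences k n alpha beta b (rcons p x) %/ occurrences k n alpha beta b p)%N.
Proof.
move=> bk pk; rewrite /table_value ffunE/=.
rewrite !insub_bseqE// inordK// ltnS.
have [->|c0] := posnP (occurrences k n alpha beta b p); first by rewrite divn0.
by rewrite -[leqRHS](mulnK _ c0) leq_div2r// leq_mul2l occurrences_rcons_le orbT.
Qed.

(** Quotients of consecutive values in [t] are the empirical probabilities of the next bit, so their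
    logarithms telescope along a block. *)
Definition prefix_count (k n : nat) (alpha beta : nat -> bool) (i t : nat) : nat :=
  occurrences k n alpha beta (substring beta (i * k) k) (substring alpha (i * k) t).

Lemma prefix_count_gt0 k n (alpha beta : nat -> bool) (i : 'I_n) t :
  (0 < prefix_count k n alpha beta i t)%N.
Proof. by apply/card_gt0P; exists i; rewrite inE size_substring !eqxx. Qed.

(** The added one compensates the rounding in the numerator, and the denominator is at most [T + 2]
    because the two rounded frequencies sum to at most [T]. *)
Lemma bit_prob_frequency_table (k T n : nat) (alpha beta : nat -> bool) (i : 'I_n) (t : nat) :
  (t < k)%N ->
  (prefix_count k n alpha beta i t.+1)%:R / (prefix_count k n alpha beta i t)%:R *
    (T%:R / T.+2%:R) <=
  bit_prob alpha beta (frequency_table k T n alpha beta) (i * k + t).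
Proof.
pose c := prefix_count k n alpha beta i.
move=> tk; have k0 : (0 < k)%N by exact: leq_ltn_trans tk.
rewrite /bit_prob divnMDl// modnMDl divn_small// addn0 modn_small//.
rewrite /table_predictor !frequency_tableE ?size_substring ?(ltnW tk)//.
rewrite -substring_rcons -!/(prefix_count _ _ _ _ _ _) -/(c t) -/(c t.+1).
set v := (_ * c t.+1 %/ c t)%N; set v0 := (_ %/ _)%N; set v1 := (_ %/ _)%N.
have ct0 : (0 < c t)%N by exact: prefix_count_gt0.
have vT : (v0 + v1 <= T)%N.
  rewrite -(leq_pmul2r ct0) mulnDl.
  apply: leq_trans (leq_add (leq_trunc_div _ _) (leq_trunc_div _ _)) _.
  by rewrite -mulnDr occurrences_rcons.
have vx : (T * c t.+1 <= v.+1 * c t)%N by rewrite ltnW// ltn_ceil.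
rewrite mulrAC mulrA -mulrA -mulrA.
rewrite [leLHS](_ : _ = (T * c t.+1)%:R / (c t)%:R / T.+2%:R); last first.
  by rewrite natrM mulrCA -!mulrA; congr (_ * (_ * _)); exact: mulrC.
apply: ler_pM; rewrite ?invr_ge0// ?divr_ge0//.
  by rewrite ler_pdivrMr ?ltr0n// -natrM ler_nat.
by rewrite lef_pV2 ?posrE ?ltr0n// ler_nat addnS addSn !ltnS.
Qed.

Lemma sum_ord_mul (V : nmodType) (n k : nat) (F : nat -> V) :
  \sum_(i < n * k) F i = \sum_(j < n) \sum_(t < k) F (j * k + t)%N.
Proof.
elim: n => [|n IH]; first by rewrite !big_ord0.
by rewrite mulSnr big_split_ord big_ord_recr/= -IH.
Qed.

(** The counts at [0] and at [k] are those of the condition block alone and of the pair of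
    blocks. *)
Lemma block_entropy_occurrences (R : realType) (k n : nat) (alpha beta : nat -> bool) :
  n%:R * block_entropy R k n alpha beta =
  \sum_(i < n)
    (log2 (prefix_count k n alpha beta i 0)%:R - log2 (prefix_count k n alpha beta i k)%:R).
Proof.
have := cond_entropy_sum R (fun i : 'I_n => block k alpha i)
  (fun i : 'I_n => block k beta i); rewrite card_ord => ->.
apply: eq_bigr => i _.
have n0 : (0 < n)%N by exact: leq_ltn_trans (ltn_ord i).
have := prefix_count_gt0 k alpha beta i k; have := prefix_count_gt0 k alpha beta i 0.
rewrite /unif_dist !card_ord.
set a := prefix_count _ _ _ _ _ _; set b := prefix_count _ _ _ _ _ _ => a0 b0.
have -> : #|[set j : 'I_n | (block k alpha j, block k beta j) ==
    (block k alpha i, block k beta i)]%SET| = b.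
  apply: eq_card => j; rewrite !inE xpair_eqE andbC size_substring.
  by rewrite -!val_eqE/= !tval_block.
have -> : #|[set j : 'I_n | block k beta j == block k beta i]%SET| = a.
  apply: eq_card => j; rewrite !inE/= eqxx andbT.
  by rewrite -!val_eqE/= !tval_block.
rewrite log2_div ?divr_gt0 ?ltr0n// !log2_div ?ltr0n//.
by ring.
Qed.

(** The chain rule for entropy: the surprisals of the bits of a block telescope to the surprisal of
    the block, and each bit loses at most [log2 (T.+2 / T)] by rounding and smoothing. *)
Lemma sum_bit_prob_frequency_table (R : realType) (k T n : nat) (alpha beta : nat -> bool) :
  (0 < T)%N ->
  \sum_(i < n * k) - log2 (ratr (bit_prob alpha beta (frequency_table k T n alpha beta) i)) <=
  n%:R * (block_entropy R k n alpha beta + k%:R * log2 (T.+2%:R / T%:R)) :> R.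
Proof.
move=> T0; rewrite mulrDr block_entropy_occurrences.
rewrite (sum_ord_mul _ _
  (fun i => - log2 (ratr (bit_prob alpha beta (frequency_table k T n alpha beta) i)))).
rewrite [n%:R * _]mulr_natl -[in _ *+ n](card_ord n) -sumr_const -big_split/=.
apply: ler_sum => i _.
pose c := prefix_count k n alpha beta i.
have c0 t : 0 < (c t)%:R :> R by rewrite ltr0n prefix_count_gt0.
rewrite -/(c 0%N) -/(c k).
have -> : log2 (c 0%N)%:R - log2 (c k)%:R =
    \sum_(t < k) (log2 (c t)%:R - log2 (c t.+1)%:R) :> R.
  rewrite -(big_mkord xpredT (fun t => log2 (c t)%:R - log2 (c t.+1)%:R)).
  rewrite (telescope_sumr_eq (fun t => - log2 (c t)%:R))// => [|t _].
    by rewrite opprK addrC.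
  by rewrite opprK addrC.
rewrite [k%:R * _]mulr_natl -[in _ *+ k](card_ord k) -sumr_const -big_split/=.
apply: ler_sum => t _.
have H := @bit_prob_frequency_table k T n alpha beta i t (ltn_ord t).
have TR : 0 < T%:R :> R by rewrite ltr0n.
have T2 : 0 < T.+2%:R :> R by rewrite ltr0n.
have -> : log2 (c t)%:R - log2 (c t.+1)%:R + log2 (T.+2%:R / T%:R) =
    - log2 ((c t.+1)%:R / (c t)%:R * (T%:R / T.+2%:R) : R).
  by rewrite (log2M (divr_gt0 (c0 t.+1) (c0 t)) (divr_gt0 TR T2)) !log2_div//; ring.
rewrite lerN2; apply: ler_log2; first by rewrite mulr_gt0 ?divr_gt0.
have -> : (c t.+1)%:R / (c t)%:R * (T%:R / T.+2%:R) =
  ratr ((c t.+1)%:R / (c t)%:R * (T%:R / T.+2%:R)) :> R.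
  by rewrite !rmorphM !fmorphV !rmorph_nat.
by rewrite ler_rat.
Qed.

(** * Choice of the parameters and the universal measure *)

Lemma affine_lt_exp2 (a b : nat) : exists w0, forall w, (w0 <= w)%N -> (a + b * w < 2 ^ w)%N.
Proof.
have sq w : (w.+4 * w.+4 <= 2 ^ w.+4)%N.
  elim: w => // w IH; rewrite expnS; apply: leq_trans (_ : 2 * (w.+4 * w.+4) <= _)%N.
    by nia.
  by rewrite leq_mul2l.
exists (a + b + 4)%N => w abw.
have -> : w = (w - 4).+4 by lia.
apply: leq_trans (sq (w - 4)%N); nia.
Qed.

Lemma log2_ratio_le (R : realType) (delta : R) : 0 < delta ->
  exists2 T : nat, (0 < T)%N & log2 (T.+2%:R / T%:R) <= delta.
Proof.
move=> d0; have l0 := ln2_gt0 R.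
have [T _ HT] := near_natr_ge 2 (mulr_gt0 d0 l0).
have [T0 HT2] := HT T (leqnn T); exists T => //.
rewrite /log2 ler_pdivrMr//; apply: le_trans HT2.
have TR : 0 < T%:R :> R by rewrite ltr0n.
have -> : T.+2%:R / T%:R = 1 + 2 / T%:R :> R.
  by rewrite -addn2 natrD mulrDl divff// gt_eqF.
by apply: le_ln1Dx; rewrite (lt_trans (_ : _ < 0)) ?ltrN10// divr_gt0.
Qed.

Lemma prediction_ge r B p A (x : rat) : 0 <= x -> (forall p a, x <= r B p a) ->
  x ^+ size A <= prediction r B p A.
Proof.
move=> x0 xr; elim: A p => //= a A IH p.
by rewrite exprS ler_pM// exprn_ge0.
Qed.

(** The measure is the mixture over all tables, so it contains the frequency table for every [N].
    The term [w.+1] pays for a code word, and the third clause lets code lengths be written with [w]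
    bits. Of the error [e], one quarter goes to the tables and one half to the overhead per long
    block. *)
Lemma universal_conditional_measure (R : realType) (alpha beta : nat -> bool)
    (k : nat) (e : R) : (0 < k)%N -> 0 < e ->
  exists (L w : nat) (mu : bitstring -> bitstring -> rat),
  [/\ (0 < L)%N, conditional_measure mu,
      (forall B A, size A = L ->
         (Num.truncn (- log2 (ratr (mu B A) : R))).+1 < 2 ^ w)%N &
      exists C : R, forall N : nat,
      \sum_(j < (N %/ L).+1) (- log2 (ratr (mu (substring beta (j * L) L)
          (substring alpha (j * L) L))) + w.+1%:R) <=
      N%:R * (block_entropy R k (N %/ k) alpha beta / k%:R + e) + C].
Proof.
move=> k0 e0; have e40 : 0 < e / 4 by rewrite divr_gt0.
have [T T0 HT] := log2_ratio_le e40.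
pose U := table k T; pose r (u : U) := long_predictor u; pose mu := mixture r.
have U0 : (0 < #|{: U}|)%N.
  by apply/card_gt0P; exists [ffun=> ord0].
have r0 u B p a : 0 < r u B p a by exact: table_predictor_gt0.
have r1 u B p : r u B p false + r u B p true = 1 by exact: table_predictor_sum1.
have Hmu : conditional_measure mu by exact: mixture_conditional_measure.
pose M1 : R := log2 #|{: U}|%:R; pose G : R := log2 (2 * T.+1)%:R.
have M10 : 0 <= M1 by rewrite log2_ge0// ler1n.
have G0 : 0 <= G by rewrite log2_ge0// ler1n.
pose m1 := (Num.truncn M1).+1; pose g := (Num.truncn G).+1.
have m1M : M1 <= m1%:R by rewrite ltW// truncnS_gt.
have gG : G <= g%:R by rewrite ltW// truncnS_gt.
pose D := (Num.truncn (4 / e)).+1.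
have De : 4 <= D%:R * e by rewrite -ler_pdivrMr// ltW// truncnS_gt.
(* Code lengths grow linearly with [L], which is proportional to [w]; the exponential [2 ^ w] still
   overtakes them. The summand [m1 + 1] in [w] ensures that the overhead [M1 + w.+1] is at most
   [2 * w], and [D] that [4 * w <= L * e]. *)
have [w0 Hw0] := affine_lt_exp2 (m1 + 2) (k * D * g).
pose w := (w0 + m1 + 1)%N; pose L := (k * (w * D))%N.
have L0 : (0 < L)%N by rewrite /L /w addn1 !muln_gt0 k0.
have mu_le u B A : - log2 (ratr (mu B A) : R) <=
    M1 - log2 (ratr (prediction (r u) B [::] A)).
  have p0 : 0 < prediction (r u) B [::] A by exact: prediction_gt0.
  have pU : 0 < ratr (prediction (r u) B [::] A) / #|{: U}|%:R :> R.
    by rewrite divr_gt0 ?ltr0q// ltr0n.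
  rewrite -[M1]opprK -opprD lerN2 addrC -log2_div ?ltr0q ?ltr0n//.
  apply: ler_log2 => //.
  have -> : ratr (prediction (r u) B [::] A) / #|{: U}|%:R =
     ratr (prediction (r u) B [::] A / #|{: U}|%:R) :> R.
    by rewrite rmorphM fmorphV rmorph_nat.
  by rewrite ler_rat mixture_ge.
exists L, w, mu; split => //.
  move=> B A AL; have [u _] := card_gt0P U0.
  set v := - log2 _.
  have v1 : v <= (m1 + L * g)%:R.
    apply: (le_trans (mu_le u B A)); rewrite natrD lerD// lerNl.
    apply: (@le_trans _ _ (- (L%:R * G))); first by rewrite lerN2 natrM ler_wpM2l.
    rewrite /G -mulrN -log2V ?ltr0n// -log2X ?invr_gt0 ?ltr0n//.
    apply: ler_log2; first by rewrite exprn_gt0// invr_gt0 ltr0n.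
    have -> : (2 * T.+1)%:R^-1 ^+ L = ratr ((2 * T.+1)%:R^-1 ^+ L) :> R.
      by rewrite rmorphXn fmorphV rmorph_nat.
    rewrite ler_rat -AL; apply: prediction_ge; first by rewrite invr_ge0.
    by move=> p a; exact: table_predictor_ge.
  have tv : (Num.truncn v <= m1 + L * g)%N.
    by have := le_truncn v1; rewrite natrK.
  apply: leq_ltn_trans (_ : m1 + 2 + k * D * g * w < _)%N.
    by rewrite /L; nia.
  by apply: Hw0; rewrite /w -addnA leq_addr.
(* The constant pays for the overhead of the block that completes the prefix and for at most [2 * L]
   bits not covered by the entropy bound, each costing at most [G]. *)
exists (M1 + w.+1%:R + (2 * L)%:R * G) => N.
set n' := (N %/ k)%N; set n := (N %/ L)%N.
(* The table depends on [N], whereas [mu] does not. *)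
pose u : U := frequency_table k T n' alpha beta.
pose f i : R := - log2 (ratr (bit_prob alpha beta u i)).
have fG i : f i <= G.
  rewrite /f lerNl /G -log2V ?ltr0n//; apply: ler_log2; first by rewrite invr_gt0 ltr0n.
  have -> : (2 * T.+1)%:R^-1 = ratr (2 * T.+1)%:R^-1 :> R by rewrite fmorphV rmorph_nat.
  by rewrite ler_rat table_predictor_ge.
apply: (@le_trans _ _ (\sum_(j < n.+1) (M1 + w.+1%:R + \sum_(t < L) f (j * L + t)%N))).
  apply: ler_sum => j _; rewrite addrAC lerD2r.
  apply: (le_trans (mu_le u _ _)); rewrite lerD2l /r.
  have kL : (k %| L)%N by rewrite dvdn_mulr.
  have := @prediction_long_block k T alpha beta u (j * L) L L 0 k0
    (dvdn_mull _ kL) kL (leqnn L).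
  rewrite addn0 /= => ->.
  rewrite rmorph_prod log2_prod => [|i _]; last by rewrite ltr0q table_predictor_gt0.
  by rewrite sumrN.
rewrite big_split/= sumr_const card_ord -[_ *+ _]mulr_natl -(sum_ord_mul _ _ f).
have nkN : (n' * k <= N)%N by exact: leq_trunc_div.
have Nnk : (N < n' * k + k)%N by rewrite -mulSnr ltn_ceil.
have NnL : (N < n.+1 * L)%N by rewrite ltn_ceil.
have nLN : (n * L <= N)%N by exact: leq_trunc_div.
have kL : (k <= L)%N by rewrite leq_pmulr// /w addn1 muln_gt0.
(* These are the bits between the last complete short block within length [N] and the end of the
   last long block: fewer than [k] before [N], at most [L] after. *)
have [q qE qL] : exists2 q, (n.+1 * L = n' * k + q)%N & (q <= 2 * L)%N.
  exists (n.+1 * L - n' * k)%N; first by rewrite subnKC// ltnW// (leq_ltn_trans nkN).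
  by rewrite leq_subLR mulSn; lia.
have S1 : \sum_(i < n.+1 * L) f i <=
    n'%:R * (block_entropy R k n' alpha beta + k%:R * (e / 4)) + (2 * L)%:R * G.
  rewrite qE big_split_ord/=; apply: lerD.
    apply: (le_trans (sum_bit_prob_frequency_table R k n' alpha beta T0)).
    by rewrite ler_wpM2l// lerD2l ler_wpM2l.
  apply: (@le_trans _ _ (\sum_(i < q) G)); first exact: ler_sum.
  by rewrite sumr_const card_ord -[_ *+ _]mulr_natl ler_wpM2r// ler_nat.
have S2 : n'%:R * (block_entropy R k n' alpha beta + k%:R * (e / 4)) <=
    N%:R * (block_entropy R k n' alpha beta / k%:R + e / 4).
  have H0 := block_entropy_ge0 R k n' alpha beta.
  have kR : 0 < k%:R :> R by rewrite ltr0n.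
  apply: (@le_trans _ _ ((n' * k)%:R * (block_entropy R k n' alpha beta / k%:R + e / 4))).
    rewrite natrM -mulrA ler_wpM2l// mulrDr lerD2r mulrCA divff ?gt_eqF// mulr1//.
  by rewrite ler_wpM2r ?ler_nat// addr_ge0 ?divr_ge0// ltW.
have S3 : M1 + w.+1%:R <= L%:R * (e / 2).
  have wL : w%:R * 4 <= L%:R * e.
    rewrite /L natrM [(w * D)%:R]natrM -!mulrA.
    apply: (@le_trans _ _ (w%:R * (D%:R * e))); first by rewrite ler_wpM2l.
    by rewrite ler_peMl ?ler1n// mulr_ge0// (le_trans _ De).
  have : w.+1%:R + m1%:R <= w%:R * 2 :> R.
    by rewrite -natrD -natrM ler_nat muln2 -addnn addSnnS leq_add2l /w addn1 ltnS leq_addl.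
  lra.
have S4 : n%:R * (M1 + w.+1%:R) <= N%:R * (e / 2).
  apply: (@le_trans _ _ (n%:R * (L%:R * (e / 2)))); first by rewrite ler_wpM2l.
  by rewrite mulrA -natrM ler_wpM2r ?ler_nat// divr_ge0// ltW.
rewrite -natr1; move: S1 S2 S4.
set x := block_entropy _ _ _ _ _ / _; set y := \sum_(i < _) _.
have : 0 <= N%:R * (e / 4) by rewrite mulr_ge0// ltW.
rewrite -/n'; move: (n'%:R * _) (2 * L)%:R => z1 z2 h1 h2 h3 h4.
lra.
Qed.

(** * Gambling with a mixture *)

(* The strategy betting according to [mu] on consecutive blocks of length
   [c.+1]: the state [None] means that a block begins, and [Some (p, B)] that
   [B] is the condition of the current block and [p] its known part without the
   last observed bit. *)
Definition measure_state (c : nat) : finType :=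
  option (c.+1.-bseq bool * c.+1.-tuple bool).

Definition current_block (c : nat) (s : measure_state c) (l : bool)
    (w : c.+1.-tuple bool) : bitstring * c.+1.-tuple bool :=
  if s is Some (p, B) then (rcons p l, B) else ([::], w).

(** When [c] bits of the block are known, the bit now bet on completes it. *)
Definition measure_next (c : nat) (s : measure_state c) (l : bool)
    (w : c.+1.-tuple bool) : measure_state c :=
  let pB := current_block s l w in
  if (size pB.1 < c)%N then Some (insub_bseq c.+1 pB.1, pB.2) else None.

Definition measure_bet (mu : bitstring -> bitstring -> rat) (c : nat)
    (s : measure_state c) (l : bool) (w : c.+1.-tuple bool) (x : bool) : rat :=
  let pB := current_block s l w in mu pB.2 (rcons pB.1 x) / mu pB.2 pB.1.

Lemma measure_bet_ge0 mu c : conditional_measure mu ->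
  forall (s : measure_state c) l w x, 0 <= measure_bet mu s l w x.
Proof. by move=> Hmu s l w x; rewrite divr_ge0// ltW// (cm_gt0 Hmu). Qed.

Lemma measure_bet_sum1 mu c : conditional_measure mu ->
  forall (s : measure_state c) l w,
  measure_bet mu s l w false + measure_bet mu s l w true = 1.
Proof.
move=> Hmu s l w; rewrite /measure_bet -mulrDl (cm_rcons Hmu) divff//.
by rewrite gt_eqF// (cm_gt0 Hmu).
Qed.

(** At the first round of a block the window is exactly its condition block, whence blocks of length
    [c.+1] for look-ahead [c]. *)
Definition measure_strategy mu c (Hmu : conditional_measure mu) : gambling_strategy :=
  GamblingStrategy None (@measure_next c) (measure_bet_ge0 (c := c) Hmu)
    (measure_bet_sum1 (c := c) Hmu).

(** The state when [t] bits of the block starting at [i] have been observed; it is [None] both at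
    [t = 0] and at [t = c.+1]. *)
Definition block_state (c : nat) (alpha beta : nat -> bool) (i t : nat) : measure_state c :=
  if (0 < t <= c)%N then
    Some (insub_bseq c.+1 (substring alpha i t.-1), window c beta i)
  else None.

Lemma current_block_state c alpha beta i t l w : (t <= c)%N ->
  (0 < t -> l = alpha (i + t.-1))%N -> (t = 0 -> w = window c beta i)%N ->
  current_block (block_state c alpha beta i t) l w =
  (substring alpha i t, window c beta i).
Proof.
case: t => [_ _ -> //|t tc lE _].
have tc1 : (size (substring alpha i t) <= c.+1)%N by rewrite size_substring ltnW// ltnW.
by rewrite /block_state tc /= insub_bseqE// lE// -substring_rcons.
Qed.

(** The bets are quotients of consecutive values of [mu] and telescope over the [s] remaining rounds
    of the block, after which the strategy restarts. *)
Lemma bet_product_block mu c (Hmu : conditional_measure mu)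
    (alpha beta : nat -> bool) (i s t n : nat) (l : bool) :
  (t + s = c.+1)%N -> (0 < t -> l = alpha (i + t.-1))%N ->
  @bet_product (measure_strategy c Hmu) alpha beta
    (block_state c alpha beta i t) l (i + t) (s + n) =
  mu (window c beta i) (substring alpha i c.+1) / mu (window c beta i) (substring alpha i t) *
  @bet_product (measure_strategy c Hmu) alpha beta None (alpha (i + c)%N) (i + c.+1) n.
Proof.
elim: s t l => [|s IH] t l tsc lE.
  move: tsc lE; rewrite addn0 => -> /= ->//.
  by rewrite /block_state ltnn divff ?mul1r// gt_eqF// (cm_gt0 Hmu).
have tc : (t <= c)%N by rewrite -ltnS -tsc addnS ltnS leq_addr.
have curE : current_block (block_state c alpha beta i t) l (window c beta (i + t)) =
    (substring alpha i t, window c beta i).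
  by apply: current_block_state => // ->; rewrite addn0.
have nextE : measure_next (block_state c alpha beta i t) l (window c beta (i + t)) =
    block_state c alpha beta i t.+1.
  by rewrite /measure_next curE /= size_substring.
have -> : @bet_product (measure_strategy c Hmu) alpha beta
    (block_state c alpha beta i t) l (i + t) (s.+1 + n) =
  measure_bet mu (block_state c alpha beta i t) l (window c beta (i + t)) (alpha (i + t)%N) *
  @bet_product (measure_strategy c Hmu) alpha beta
    (measure_next (block_state c alpha beta i t) l (window c beta (i + t)))
    (alpha (i + t)%N) (i + t).+1 (s + n) by [].
rewrite nextE -addnS IH ?addSnnS// /measure_bet curE -[(_, _).1]/(substring alpha i t).
rewrite -[(_, _).2]/(window c beta i) -substring_rcons mulrA; congr (_ * _).
have := cm_gt0 Hmu (window c beta i) (substring alpha i t.+1).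
set x := mu _ _; set y := mu _ _; set z := mu _ _ => x0.
by rewrite mulrC mulrA divfK// gt_eqF.
Qed.

Lemma bet_product_blocks mu c (Hmu : conditional_measure mu)
    (alpha beta : nat -> bool) (i n : nat) (l : bool) :
  @bet_product (measure_strategy c Hmu) alpha beta None l (i * c.+1) (n * c.+1) =
  \prod_(j < n) mu (substring beta ((i + j) * c.+1) c.+1)
                   (substring alpha ((i + j) * c.+1) c.+1).
Proof.
elim: n i l => [|n IH] i l; first by rewrite big_ord0.
have := @bet_product_block mu c Hmu alpha beta (i * c.+1) c.+1 0 (n * c.+1) l
  (add0n _) (fun H => False_ind _ (notF H)).
rewrite addn0 mulSn => ->.
rewrite (cm_nil Hmu) divr1 tval_window -mulSnr IH big_ord_recl addn0; congr (_ * _).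
by apply: eq_bigr => j _; rewrite lift0 addSnnS.
Qed.

(** Completing the last block can only lower the product of the bets, so the prefix is bounded by
    whole blocks. *)
Lemma measure_strategy_cost (R : realType) mu c (Hmu : conditional_measure mu)
    (alpha beta : nat -> bool) (N : nat) :
  (N%:R%:E - log2e (ratr (capital (measure_strategy c Hmu) (substring alpha 0 N)
      (substring beta 0 (N + gs_lookahead (measure_strategy c Hmu)))) : R) <=
   (\sum_(j < (N %/ c.+1).+1) - log2 (ratr (mu (substring beta (j * c.+1) c.+1)
      (substring alpha (j * c.+1) c.+1))))%:E)%E.
Proof.
rewrite /capital (@capital_from_bet_product (measure_strategy c Hmu)).
set p := bet_product _ _ _ _ _ _.
set n := (N %/ c.+1)%N.
set q := \prod_(j < n.+1) mu (substring beta (j * c.+1) c.+1)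
                   (substring alpha (j * c.+1) c.+1).
have q0 : 0 < q by apply: prodr_gt0 => j _; exact: cm_gt0 Hmu _ _.
have Nn : (N <= n.+1 * c.+1)%N by rewrite ltnW// ltn_ceil.
have qp : q <= p.
  have := @bet_product_blocks mu c Hmu alpha beta 0 n.+1 false.
  rewrite mul0n (eq_bigr (fun j : 'I_n.+1 => mu (substring beta (j * c.+1) c.+1)
    (substring alpha (j * c.+1) c.+1)))// -/q => <-.
  by rewrite -(subnKC Nn); exact: bet_product_add.
have p0 : 0 < p by exact: lt_le_trans qp.
have pR : 0 < ratr p :> R by rewrite ltr0q.
have p2 : 0 < 2 ^+ N * ratr p :> R by apply: mulr_gt0 => //; rewrite exprn_gt0.
rewrite rmorphM rmorphXn rmorph_nat log2e_EFin//.
rewrite -EFinB lee_fin (log2M (exprn_gt0 N (ltr0n R 2)) pR) log2_pow2 opprD addNKr.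
apply: (@le_trans _ _ (- log2 (ratr q))); first by rewrite lerN2 ler_log2 ?ltr0q// ler_rat.
rewrite rmorph_prod log2_prod => [|j _]; last by rewrite ltr0q (cm_gt0 Hmu).
by rewrite sumrN.
Qed.

(** * Coding with a mixture *)

(** A fixed-length notation for the numbers below [2 ^ n], of which only injectivity matters. *)
Definition nth_tuple (n i : nat) : n.-tuple bool :=
  nth [tuple of nseq n false] (enum {: n.-tuple bool}) i.

Lemma nth_tuple_inj n i j : (i < 2 ^ n)%N -> (j < 2 ^ n)%N ->
  nth_tuple n i = nth_tuple n j -> i = j.
Proof.
have sz : size (enum {: n.-tuple bool}) = (2 ^ n)%N by rewrite -cardE card_tuple card_bool.
move=> i2 j2 /eqP; rewrite /nth_tuple nth_uniq ?sz ?enum_uniq//.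
by move/eqP.
Qed.

(** Injectivity and prefix-freeness at once, for each condition [B] separately. *)
Definition prefix_code (L : nat) (code : L.-tuple bool -> L.-tuple bool -> bitstring) : Prop :=
  forall B A A' s s', code B A ++ s = code B A' ++ s' -> A = A'.

(* A code word consists of the code length of [A], written with [w] bits, and
   the index of [A] among the strings with the same code length. *)
Lemma exists_prefix_code (R : realType) (L w : nat) (mu : bitstring -> bitstring -> rat) :
  conditional_measure mu ->
  (forall B A, size A = L -> (Num.truncn (- log2 (ratr (mu B A) : R))).+1 < 2 ^ w)%N ->
  exists2 code : L.-tuple bool -> L.-tuple bool -> bitstring, prefix_code code &
    forall B A, (size (code B A))%:R <= - log2 (ratr (mu B A)) + w.+1%:R :> R.
Proof.
move=> Hmu Hw.
pose len (B A : L.-tuple bool) := (Num.truncn (- log2 (ratr (mu B A) : R))).+1.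
pose S (B : L.-tuple bool) l := [set A : L.-tuple bool | len B A == l]%SET.
pose code B A := nth_tuple w (len B A) ++ nth_tuple (len B A) (index A (enum (S B (len B A)))).
(* A string with code length [l] has probability at least [2 ^- l], so its index fits into [l]
   bits. *)
have cardS B l : (#|S B l| <= 2 ^ l)%N.
  have muS A : A \in S B l -> 2 ^- l <= mu B A.
    rewrite inE => /eqP lE; have mu0 := cm_gt0 Hmu B A.
    have p2 : 0 < 2 ^- l :> R by rewrite invr_gt0 exprn_gt0.
    rewrite -(ler_rat R) fmorphV rmorphXn rmorph_nat leNgt; apply/negP => lt2.
    have : log2 (ratr (mu B A)) <= log2 (2 ^- l) :> R.
      by apply: ler_log2; rewrite ?ltr0q// ltW.
    rewrite log2V ?exprn_gt0// log2_pow2 lerNr leNgt => /negP; apply.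
    by rewrite -lE truncnS_gt.
  rewrite -(ler_nat rat) natrX -[leRHS]mul1r -ler_pdivrMr ?exprn_gt0//.
  rewrite mulr_natl -sumr_const.
  have S1 := sum_conditional_measure Hmu L B [::]; rewrite (cm_nil Hmu) in S1.
  rewrite -[leRHS]S1.
  apply: (@le_trans _ _ (\sum_(A in S B l) mu B A)); first exact: ler_sum.
  rewrite big_mkcond/=; apply: ler_sum => A _; case: ifP => // _.
  by rewrite ltW// (cm_gt0 Hmu).
have idx B A : (index A (enum (S B (len B A))) < 2 ^ len B A)%N.
  by apply: leq_trans (cardS B _); rewrite cardE index_mem mem_enum inE.
exists code => [B A A' s s'|B A].
  rewrite /code -!catA => /eqP; rewrite eqseq_cat ?size_tuple// => /andP[/eqP/val_inj E1 E2].
  have lE : len B A = len B A' by apply: (nth_tuple_inj _ _ E1); apply: Hw; rewrite size_tuple.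
  move: E2; rewrite -lE eqseq_cat ?size_tuple// => /andP[/eqP/val_inj E2 _].
  have idx' : (index A' (enum (S B (len B A))) < 2 ^ len B A)%N.
    by have := idx B A'; rewrite -lE.
  have iE := nth_tuple_inj (idx B A) idx' E2.
  have AS : A \in enum (S B (len B A)) by rewrite mem_enum inE.
  have AS' : A' \in enum (S B (len B A)) by rewrite mem_enum inE lE.
  by rewrite -(nth_index A AS) iE nth_index.
rewrite /code size_cat !size_tuple natrD -addn1 addrC natrD.
rewrite [_ + 1]addrC addrA lerD2r -natr1 lerD2r truncn_le oppr_ge0 log2_le0//.
  by rewrite ltr0q (cm_gt0 Hmu).
rewrite -(rmorph1 (@ratr R)) ler_rat.
have S1 := sum_conditional_measure Hmu L B [::]; rewrite (cm_nil Hmu) in S1.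
rewrite -[leRHS]S1 (bigD1 A)//= lerDl sumr_ge0// => A' _.
by rewrite ltW// (cm_gt0 Hmu).
Qed.

(** * The graph of a prefix code *)

Lemma pmap_onth_iota (T : Type) (s : seq T) (M : nat) : (size s <= M)%N ->
  pmap (onth s) (iota 0 M) = s.
Proof.
elim: s M => [|x s IH] [|M]//=.
  by move=> _; elim: (iota _ _) => //= -[|i] r ->.
move=> sM; congr (_ :: _); rewrite -[1%N]addn0 iotaDl -[RHS](IH M)//.
by elim: (iota 0 M) => //= i r ->.
Qed.

Lemma size_pmap_onth_iota (T : Type) (s : seq T) (n : nat) :
  (size (pmap (onth s) (iota 0 n)) <= size s)%N.
Proof.
rewrite -[in leqRHS](pmap_onth_iota (leq_addl n (size s))) iotaD pmap_cat.
by rewrite size_cat leq_addr.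
Qed.

(* The cycle of a pair [(A, B)] of blocks has [M.+1] edges; their labels spell
   [A], [B] and the code word of [A]. After a cycle the next one is chosen
   freely. *)
Section CodeGraph.
Variables (L M : nat) (code : L.-tuple bool -> L.-tuple bool -> bitstring).
Hypotheses (L0 : (0 < L)%N) (LM : (L <= M.+1)%N).
Hypothesis codeM : forall B A, (size (code B A) <= M.+1)%N.
Hypothesis codeP : prefix_code code.

Definition code_vertex : finType := (L.-tuple bool * L.-tuple bool * 'I_M.+1)%type.
(** The second component selects the next cycle at the last edge of a cycle; on earlier edges it
    yields parallel edges with equal labels. *)
Definition code_edge : finType := (code_vertex * (L.-tuple bool * L.-tuple bool))%type.
Definition code_dst (e : code_edge) : code_vertex :=
  if (e.1.2 < M)%N then (e.1.1, inord e.1.2.+1) else (e.2, ord0).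
Definition code_io (v : code_vertex) : option (bool * bool) := onth (zip v.1.1 v.1.2) v.2.
Definition code_descr (v : code_vertex) : option bool := onth (code v.1.2 v.1.1) v.2.

Definition code_graph : labeled_graph :=
  @LabeledGraph code_vertex code_edge fst code_dst
    (fun e => code_io e.1) (fun e => code_descr e.1).

Definition walk_end (v : code_vertex) (w : seq code_edge) := last v (map code_dst w).

Definition cycle_part (AB : L.-tuple bool * L.-tuple bool) (j n : nat) : seq code_vertex :=
  [seq (AB, inord i) | i <- iota j n].

(** Inside a cycle the vertices are forced. The [else] branch is a tautology: after the last edge
    only the phase of the end is known, as the third conjunct says. *)
Lemma walk_sources (AB : L.-tuple bool * L.-tuple bool) (j : nat) (w : seq code_edge) :
  (j + size w <= M.+1)%N -> (j <= M)%N -> @is_walk code_graph (AB, inord j) w ->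
  map fst w = cycle_part AB j (size w) /\
  walk_end (AB, inord j) w =
    (if (j + size w <= M)%N then (AB, inord (j + size w)) else walk_end (AB, inord j) w) /\
  ((j + size w = M.+1)%N -> (walk_end (AB, inord j) w).2 = ord0).
Proof.
elim: w j => [|e w IH] j /= jM jM'.
  rewrite addn0 jM'; split => //; split => // jE; by move: jM'; rewrite jE ltnn.
move=> /andP[/eqP eE ww].
have jE : nat_of_ord (inord j : 'I_M.+1) = j by rewrite inordK.
rewrite /walk_end /= -/(walk_end _ _).
have dE : code_dst e = if (j < M)%N then (AB, inord j.+1) else (e.2, ord0).
  by rewrite /code_dst [e.1]eE /= jE.
move: ww; rewrite dE; case: ltnP => jM1 ww.
  have [||-> [{}H1 H2]] := IH j.+1 _ _ ww; first by rewrite addSnnS.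
    by [].
  rewrite eE addnS -addSn; split => //; split => //; exact: H2.
have w0 : w = [::].
  apply/nilP; rewrite /nilp -leqn0 -(leq_add2l j) addn0 (leq_trans _ jM1)//.
  by rewrite -ltnS -addnS.
by rewrite w0 /= eE addn1 ltnNge jM1.
Qed.

Lemma pmap_fst (T : Type) (f : code_vertex -> option T) (w : seq code_edge) :
  pmap (fun e => f e.1) w = pmap f (map fst w).
Proof. by elim: w => //= e w ->. Qed.

Lemma pmap_cycle_part (T : Type) (f : code_vertex -> option T) (g : nat -> option T) AB n :
  (forall i, (i <= M)%N -> f (AB, inord i) = g i) -> (n <= M.+1)%N ->
  pmap f (cycle_part AB 0 n) = pmap g (iota 0 n).
Proof.
move=> fg nM; rewrite /cycle_part.
have : all (fun i => i <= M)%N (iota 0 n).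
  by apply/allP => i; rewrite mem_iota add0n => /leq_trans /(_ nM).
by elim: (iota 0 n) => //= i r IH /andP[iM /IH->]; rewrite fg.
Qed.

Lemma code_io_cycle AB n : (n <= M.+1)%N ->
  pmap code_io (cycle_part AB 0 n) = pmap (onth (zip AB.1 AB.2)) (iota 0 n).
Proof.
by apply: pmap_cycle_part => i iM; rewrite /code_io/= inordK.
Qed.

Lemma code_descr_cycle AB n : (n <= M.+1)%N ->
  pmap code_descr (cycle_part AB 0 n) = pmap (onth (code AB.2 AB.1)) (iota 0 n).
Proof.
by apply: pmap_cycle_part => i iM; rewrite /code_descr/= inordK.
Qed.

Lemma size_zip_block (AB : L.-tuple bool * L.-tuple bool) : size (zip AB.1 AB.2) = L.
Proof. by rewrite size_zip !size_tuple minnn. Qed.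

Lemma walk_full_cycle (AB : L.-tuple bool * L.-tuple bool) (w : seq code_edge) :
  (M < size w)%N -> @is_walk code_graph (AB, inord 0) w ->
  exists w' v, [/\ (size w' < size w)%N, v.2 = ord0, @is_walk code_graph v w',
    walk_end (AB, inord 0) w = walk_end v w' &
    pmap (@lg_io code_graph) w = zip AB.1 AB.2 ++ pmap (@lg_io code_graph) w' /\
    pmap (@lg_descr code_graph) w =
      code AB.2 AB.1 ++ pmap (@lg_descr code_graph) w'].
Proof.
move=> Mw; rewrite -(cat_take_drop M.+1 w) is_walk_cat => /andP[ww1 ww2].
have sw1 : size (take M.+1 w) = M.+1 by rewrite size_takel.
have [E1 [_ E2]] := @walk_sources AB 0 (take M.+1 w) (eq_leq sw1) (leq0n _) ww1.
exists (drop M.+1 w), (walk_end (AB, inord 0) (take M.+1 w)); split => //.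
- by rewrite cat_take_drop size_drop ltn_subrL/= (leq_trans _ Mw).
- by apply: E2; rewrite sw1.
- by rewrite /walk_end map_cat last_cat.
split; rewrite pmap_cat; congr (_ ++ _).
  rewrite [LHS](pmap_fst code_io) E1 sw1 code_io_cycle// pmap_onth_iota//.
  by rewrite size_zip_block.
by rewrite [LHS](pmap_fst code_descr) E1 sw1 code_descr_cycle// pmap_onth_iota.
Qed.

Lemma walk_partial_cycle (AB : L.-tuple bool * L.-tuple bool) (w : seq code_edge) :
  (size w <= M)%N -> @is_walk code_graph (AB, inord 0) w ->
  [/\ walk_end (AB, inord 0) w = (AB, inord (size w)),
    pmap (@lg_io code_graph) w = pmap (onth (zip AB.1 AB.2)) (iota 0 (size w)) &
    pmap (@lg_descr code_graph) w = pmap (onth (code AB.2 AB.1)) (iota 0 (size w))].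
Proof.
move=> wM ww; have [E1 [E2 _]] := @walk_sources AB 0 w (leqW wM) (leq0n _) ww.
rewrite E2 add0n wM; split => //.
  by rewrite [LHS](pmap_fst code_io) E1 code_io_cycle// leqW.
by rewrite [LHS](pmap_fst code_descr) E1 code_descr_cycle// leqW.
Qed.

Lemma phase0 (v : code_vertex) : v.2 = ord0 -> v = (v.1, inord 0).
Proof.
by case: v => AB j /= ->; congr pair; apply/val_inj; rewrite /= inordK.
Qed.

(** The short walk reads at most [L] pairs. The long one reads [L] in its first cycle, and one more
    at once if it continues; if it stops there, the common end has phase [0], so the short walk is
    empty and reads none. *)
Lemma walk_partial_full (v1 v2 : code_vertex) (w1 w2 : seq code_edge) :
  v1.2 = ord0 -> v2.2 = ord0 -> (size w1 <= M)%N -> (M < size w2)%N ->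
  @is_walk code_graph v1 w1 -> @is_walk code_graph v2 w2 ->
  walk_end v1 w1 = walk_end v2 w2 ->
  size (pmap (@lg_io code_graph) w1) <> size (pmap (@lg_io code_graph) w2).
Proof.
move=> /phase0 -> /phase0 -> w1M w2M ww1 ww2 wE.
have [E1 io1 _] := walk_partial_cycle w1M ww1.
have [w' [v [_ v0 ww' E2 [io2 _]]]] := walk_full_cycle w2M ww2.
rewrite io2 size_cat size_zip_block => sE.
have sL : (size (pmap (@lg_io code_graph) w1) <= L)%N.
  by rewrite io1 (leq_trans (size_pmap_onth_iota _ _))// size_zip_block.
case: w' => [|e w'] in ww' E2 io2 sE *.
  move: wE; rewrite E1 E2 /walk_end/= => /(congr1 snd)/=; rewrite v0.
  move=> /(congr1 (@nat_of_ord _)); rewrite /= inordK// => w10.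
  by move: sE L0; rewrite io1 w10/= addn0 => <-.
move: ww' sE => /= /andP[/eqP ee _]; rewrite /code_io ee v0 /=.
have : (0 < size (zip v.1.1 v.1.2))%N by rewrite size_zip_block.
case: (zip _ _) => //= x r _ sE; move: sL; rewrite sE /=.
by rewrite addnS ltnNge leq_addr.
Qed.

(** Full cycles are compared one at a time: equal conditions give equal condition blocks, and then
    the prefix property gives equal blocks. A final partial cycle is known from the common end
    vertex, which records its pair and phase. *)
Lemma walk_determined (v1 v2 : code_vertex) (w1 w2 : seq code_edge) :
  v1.2 = ord0 -> v2.2 = ord0 ->
  @is_walk code_graph v1 w1 -> @is_walk code_graph v2 w2 ->
  walk_end v1 w1 = walk_end v2 w2 ->
  map snd (pmap (@lg_io code_graph) w1) = map snd (pmap (@lg_io code_graph) w2) ->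
  pmap (@lg_descr code_graph) w1 = pmap (@lg_descr code_graph) w2 ->
  map fst (pmap (@lg_io code_graph) w1) = map fst (pmap (@lg_io code_graph) w2).
Proof.
have [n] := ubnP (size w1); elim: n w1 w2 v1 v2 => // n IH w1 w2 v1 v2 w1n v10 v20.
move=> ww1 ww2 wE ioE pE.
have sE : size (pmap (@lg_io code_graph) w1) = size (pmap (@lg_io code_graph) w2).
  by rewrite -(size_map snd) ioE size_map.
have [w1M|w1M] := leqP (size w1) M; have [w2M|w2M] := leqP (size w2) M.
- move: ww1 ww2 wE; rewrite (phase0 v10) (phase0 v20) => ww1 ww2.
  have [-> -> _] := walk_partial_cycle w1M ww1.
  have [-> -> _] := walk_partial_cycle w2M ww2.
  by move=> /eqP; rewrite xpair_eqE => /andP[/eqP-> /eqP/(congr1 (@nat_of_ord _))];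
    rewrite !inordK// => ->.
- by have := walk_partial_full v10 v20 w1M w2M ww1 ww2 wE.
- by have := walk_partial_full v20 v10 w2M w1M ww2 ww1 (esym wE) (esym sE).
move: ww1 ww2 wE; rewrite (phase0 v10) (phase0 v20) => ww1 ww2.
have [w1' [v1' [w1'n v1'0 ww1' -> [io1 p1]]]] := walk_full_cycle w1M ww1.
have [w2' [v2' [w2'n v2'0 ww2' -> [io2 p2]]]] := walk_full_cycle w2M ww2.
move=> wE; move: ioE pE; rewrite io1 io2 p1 p2 !map_cat.
have unz2 (AB : L.-tuple bool * L.-tuple bool) : map snd (zip AB.1 AB.2) = AB.2.
  by rewrite -/(unzip2 _) unzip2_zip// !size_tuple.
have unz1 (AB : L.-tuple bool * L.-tuple bool) : map fst (zip AB.1 AB.2) = AB.1.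
  by rewrite -/(unzip1 _) unzip1_zip// !size_tuple.
rewrite !unz1 !unz2 => /eqP; rewrite eqseq_cat ?size_tuple//.
move=> /andP[/eqP/val_inj BE /eqP ioE] pE.
have AE : v1.1.1 = v2.1.1 by apply: codeP; rewrite -BE in pE; exact: pE.
rewrite AE; congr (_ ++ _); apply: (IH w1' w2' v1' v2') => //.
  by rewrite -ltnS (leq_trans _ w1n).
move: pE; rewrite AE BE => /eqP; rewrite eqseq_cat// => /andP[_ /eqP//].
Qed.

Lemma cycle_walk (AB AB' : L.-tuple bool * L.-tuple bool) (j n : nat) :
  (j + n <= M)%N ->
  let w := [seq ((AB, inord i), AB') | i <- iota j n] in
  @is_walk code_graph (AB, inord j) w /\ walk_end (AB, inord j) w = (AB, inord (j + n)).
Proof.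
elim: n j => [|n IH] j jnM /=; first by rewrite addn0.
have jM : (j < M)%N by rewrite (leq_trans _ jnM)// addnS ltnS leq_addr.
have jE : nat_of_ord (inord j : 'I_M.+1) = j by rewrite inordK// ltnW.
have dE : code_dst ((AB, inord j), AB') = (AB, inord j.+1) by rewrite /code_dst /= jE jM.
rewrite /walk_end /= dE eqxx -/(walk_end _ _) addnS -addSn.
by apply: IH; rewrite addSn -addnS.
Qed.

(** Prepending the start of the cycle, from phase [0] up to [v], to both walks reduces to walks
    starting at phase [0]. *)
Lemma walk_determined_same_start (v : code_vertex) (w1 w2 : seq code_edge) :
  @is_walk code_graph v w1 -> @is_walk code_graph v w2 ->
  walk_end v w1 = walk_end v w2 ->
  map snd (pmap (@lg_io code_graph) w1) = map snd (pmap (@lg_io code_graph) w2) ->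
  pmap (@lg_descr code_graph) w1 = pmap (@lg_descr code_graph) w2 ->
  map fst (pmap (@lg_io code_graph) w1) = map fst (pmap (@lg_io code_graph) w2).
Proof.
move=> ww1 ww2 wE ioE pE.
have vM : (0 + v.2 <= M)%N by rewrite -ltnS ltn_ord.
have [ww0 w0E] := cycle_walk v.1 v.1 vM.
set w0 := map _ _ in ww0 w0E.
have vE : (v.1, inord (0 + v.2)) = v.
  by case: (v) => AB j /=; congr pair; exact: inord_val.
rewrite vE in w0E.
have cat0 w : @is_walk code_graph v w ->
    @is_walk code_graph (v.1, inord 0) (w0 ++ w) /\
    walk_end (v.1, inord 0) (w0 ++ w) = walk_end v w.
  move=> ww; rewrite is_walk_cat ww0 /walk_end map_cat last_cat.
  by rewrite -/(walk_end (v.1, inord 0) w0) w0E; split.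
have [ww1' w1E] := cat0 _ ww1; have [ww2' w2E] := cat0 _ ww2.
have z0 : (v.1, inord 0 : 'I_M.+1).2 = ord0 by apply/val_inj; rewrite /= inordK.
have := walk_determined z0 z0 ww1' ww2'.
rewrite w1E w2E !pmap_cat !map_cat ioE pE => /(_ wE erefl erefl).
by move=> /eqP; rewrite eqseq_cat// => /andP[_ /eqP].
Qed.

(** Given the condition and the description, the string is determined by the two end vertices of its
    walk, so there are no more strings than pairs of vertices. *)
Lemma code_graph_mode : description_mode code_graph.
Proof.
exists #|{: code_vertex * code_vertex}| => B P.
pose Q (vv : code_vertex * code_vertex) := [set A : bitstring | exists w,
  [/\ @is_walk code_graph vv.1 w, walk_end vv.1 w = vv.2,
      A = map fst (pmap (@lg_io code_graph) w),
      B = map snd (pmap (@lg_io code_graph) w) &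
      P = pmap (@lg_descr code_graph) w]].
(* This picks the string belonging to the pair of vertices of rank [n]; the default occurs when that
   pair has none. *)
pose g n := xget [::] [set A | exists2 vv, Q vv A & nat_of_ord (enum_rank vv) = n].
apply: card_le_trans (card_image_le g _); apply: subset_card_le.
move=> A /describes_io[v [w [ww AE BE PE]]].
pose vv := (v, walk_end v w).
exists (enum_rank vv : nat); first exact: ltn_ord.
have QA : Q vv A by exists w.
have [vv' [w' [ww' wE' AE' BE' PE']] vvE] :
    [set A | exists2 vv', Q vv' A & nat_of_ord (enum_rank vv') = enum_rank vv] (g (enum_rank vv)).
  apply: (@xgetPex _ [::] [set A |
    exists2 vv', Q vv' A & nat_of_ord (enum_rank vv') = enum_rank vv]).
  by exists A, vv.
have {}vvE : vv' = vv by apply: enum_rank_inj; exact: val_inj.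
rewrite vvE in ww' wE'.
rewrite AE' AE; apply: (walk_determined_same_start ww' ww wE').
  by rewrite -BE'.
by rewrite -PE'.
Qed.

Lemma code_graph_describes (alpha beta : nat -> bool) (i n : nat) :
  exists P, describes code_graph (substring alpha i (n * L)) (substring beta i (n * L)) P /\
  size P = (\sum_(j < n) size (code [tuple of substring beta (i + j * L) L]
                                   [tuple of substring alpha (i + j * L) L]))%N.
Proof.
pose blk i : L.-tuple bool * L.-tuple bool :=
  ([tuple of substring alpha i L], [tuple of substring beta i L]).
suff [w [ww ioE pE]] : exists w, [/\ @is_walk code_graph (blk i, inord 0) w,
    pmap (@lg_io code_graph) w = zip (substring alpha i (n * L)) (substring beta i (n * L)) &
    size (pmap (@lg_descr code_graph) w) =
      (\sum_(j < n) size (code (blk (i + j * L)%N).2 (blk (i + j * L)%N).1))%N].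
  exists (pmap (@lg_descr code_graph) w); split => //.
  apply/describes_io; exists (blk i, inord 0), w; split => //; rewrite ioE.
    by rewrite -/(unzip1 _) unzip1_zip// !size_substring.
  by rewrite -/(unzip2 _) unzip2_zip// !size_substring.
elim: n i => [|n IH] i; first by exists [::]; rewrite big_ord0.
have [w [ww ioE pE]] := IH (i + L)%N.
have [wc wcE] := cycle_walk (blk i) (blk (i + L)%N) (leqnn (0 + M)).
set w1 := map _ _ in wc wcE.
(* The closing edge of the cycle leads to the next pair of blocks. *)
pose w2 := w1 ++ [:: ((blk i, inord M), blk (i + L)%N)].
have sw2 : size w2 = M.+1 by rewrite size_cat size_map size_iota addn1.
have ww2 : @is_walk code_graph (blk i, inord 0) w2.
  rewrite is_walk_cat wc /= -/(walk_end (blk i, inord 0) w1) wcE add0n.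
  by rewrite eqxx.
have w2E : walk_end (blk i, inord 0) w2 = (blk (i + L)%N, inord 0).
  rewrite /walk_end map_cat last_cat /= /code_dst /= inordK// ltnn.
  by congr pair; apply/val_inj; rewrite /= inordK.
have [E1 _] := @walk_sources (blk i) 0 w2 (eq_leq sw2) (leq0n _) ww2.
exists (w2 ++ w); split.
- by rewrite is_walk_cat ww2 -/(walk_end (blk i, inord 0) w2) w2E ww.
- rewrite pmap_cat ioE mulSn !substring_cat zip_cat ?size_substring//; congr (_ ++ _).
  rewrite [LHS](pmap_fst code_io) E1 sw2 code_io_cycle// pmap_onth_iota//.
  by rewrite size_zip_block.
- rewrite pmap_cat size_cat pE big_ord_recl/= mul0n addn0; congr (_ + _)%N.
    rewrite [pmap _ w2](pmap_fst code_descr) E1 sw2 code_descr_cycle//.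
    by rewrite pmap_onth_iota.
  by apply: eq_bigr => j _; rewrite /bump/= add1n mulSn addnA.
Qed.

(** Both strings are padded with zeros to whole blocks, and the walk is then cut. *)
Lemma code_graph_total (A B : bitstring) : size A = size B ->
  exists P, describes code_graph A B P.
Proof.
move=> AB; have [P [D _]] := code_graph_describes (nth false A) (nth false B) 0 (size A).
have AE : substring (nth false A) 0 (size A) = A by exact: mkseq_nth.
have BE : substring (nth false B) 0 (size A) = B by rewrite AB; exact: mkseq_nth.
have sAL : (size A <= size A * L)%N by rewrite leq_pmulr.
move: D; rewrite -(subnKC sAL) !substring_cat AE BE => D.
by have [P1 [P2 [_ D1 _]]] := describes_cat AB D; exists P1.
Qed.

Lemma code_graph_complexity_le (R : realType) (alpha beta : nat -> bool) (N : nat) :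
  (automatic_complexity R code_graph (substring alpha 0 N) (substring beta 0 N) <=
   (\sum_(j < (N %/ L).+1) (size (code [tuple of substring beta (j * L) L]
      [tuple of substring alpha (j * L) L]))%:R)%:E)%E.
Proof.
have [P [D PE]] := code_graph_describes alpha beta 0 (N %/ L).+1.
have NL : (N <= (N %/ L).+1 * L)%N by rewrite ltnW// ltn_ceil.
move: D; rewrite -(subnKC NL) !substring_cat => /describes_cat.
rewrite !size_substring => /(_ erefl)[P1 [P2 [PE' D _]]].
apply: le_trans (automatic_complexity_le R D) _.
rewrite lee_fin -natr_sum ler_nat.
apply: (@leq_trans (size P)); first by rewrite PE' size_cat leq_addr.
by rewrite PE.
Qed.

End CodeGraph.

Lemma exists_code_graph (R : realType) (alpha beta : nat -> bool) (L w : nat)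
    (mu : bitstring -> bitstring -> rat) :
  (0 < L)%N -> conditional_measure mu ->
  (forall B A, size A = L -> (Num.truncn (- log2 (ratr (mu B A) : R))).+1 < 2 ^ w)%N ->
  exists Gamma : labeled_graph, [/\ description_mode Gamma,
    (forall A B, size A = size B -> exists P, describes Gamma A B P) &
    forall N, (automatic_complexity R Gamma (substring alpha 0 N) (substring beta 0 N) <=
      (\sum_(j < (N %/ L).+1) (- log2 (ratr (mu (substring beta (j * L) L)
          (substring alpha (j * L) L))) + w.+1%:R))%:E)%E].
Proof.
move=> L0 Hmu Hw; have [code codeP code_size] := exists_prefix_code Hmu Hw.
(* Cycles are long enough for a block and for the longest code word. *)
pose M := (L + \max_(AB : L.-tuple bool * L.-tuple bool) size (code AB.2 AB.1))%N.
have LM : (L <= M.+1)%N by rewrite leqW// leq_addr.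
have codeM B A : (size (code B A) <= M.+1)%N.
  apply/leqW/(leq_trans _ (leq_addl _ _)).
  exact: (@leq_bigmax _ (fun AB : L.-tuple bool * L.-tuple bool => size (code AB.2 AB.1)) (A, B)).
exists (code_graph M code); split.
- exact: code_graph_mode.
- exact: code_graph_total.
move=> N; apply: (le_trans (code_graph_complexity_le L0 LM codeM R alpha beta N)).
by rewrite lee_fin; apply: ler_sum => j _; exact: code_size.
Qed.

(** * Equality of the dimensions *)

Lemma le_1subC (R : realType) (x y : \bar R) : (x <= 1 - y)%E = (y <= 1 - x)%E.
Proof.
by case: x y => [x| |] [y| |]//=; rewrite ?leey ?leNye// -!EFinB !lee_fin; apply/idP/idP; lra.
Qed.

Lemma ereal_inf_1sub (R : realType) (S : set (\bar R)) :
  ereal_inf [set (1 - x)%E | x in S] = (1 - ereal_sup S)%E.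
Proof.
apply/eqP; rewrite eq_le; apply/andP; split; last first.
  apply: le_ereal_inf_tmp => _ [x Sx <-].
  by rewrite leeB// ereal_sup_ubound.
rewrite le_1subC; apply: ge_ereal_sup => x Sx; rewrite le_1subC.
by apply: ereal_inf_lbound; exists x.
Qed.

Lemma normalized_entropy_itv (R : realType) (alpha beta : nat -> bool) (k n : nat) :
  0 <= block_entropy R k n alpha beta / k%:R <= 1.
Proof.
case: k => [|k]; first by rewrite invr0 mulr0 lexx ler01.
rewrite divr_ge0 ?block_entropy_ge0//= ler_pdivrMr ?ltr0n// mul1r.
exact: block_entropy_le.
Qed.

(** * The classes of costs and their bounds *)

Definition gambling_costs (R : realType) (alpha beta : nat -> bool) : set (nat -> \bar R) :=
  [set c | exists G : gambling_strategy, c = fun N => (N%:R%:E -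
    log2e (ratr (capital G (substring alpha 0 N)
                  (substring beta 0 (N + gs_lookahead G)%N)) : R))%E].

Definition automatic_costs (R : realType) (alpha beta : nat -> bool) : set (nat -> \bar R) :=
  [set c | exists2 Gamma : labeled_graph, description_mode Gamma & c = fun N =>
    automatic_complexity R Gamma (substring alpha 0 N) (substring beta 0 N)].

Definition superadditive_costs (R : realType) (alpha beta : nat -> bool) : set (nat -> \bar R) :=
  [set c | exists2 K : bitstring -> bitstring -> R, superadditive_measure K & c = fun N =>
    (K (substring alpha 0 N) (substring beta 0 N))%:E].

Definition apriori_costs (R : realType) (alpha beta : nat -> bool) : set (nat -> \bar R) :=
  [set x | exists (M : prob_process) (c : nat), x = fun N =>
    apriori_complexity R M (substring alpha 0 N) (substring beta c N)].

Lemma cost_lower_bound_of_log (R : realType) (alpha beta : nat -> bool)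
    (Cl : set (nat -> \bar R)) :
  (forall c, Cl c -> exists2 C : R, 0 <= C & forall k N, (0 < k)%N ->
    ((N%:R * (block_entropy R k (N %/ k) alpha beta / k%:R
     - log2 (2 * C * k.+1%:R + 1) / k%:R) - k%:R)%:E <= c N)%E) ->
  cost_lower_bound (fun k n => block_entropy R k n alpha beta / k%:R) Cl.
Proof.
move=> H c /H[C C0 HC]; exists (fun k => log2 (2 * C * k.+1%:R + 1) / k%:R).
  exact: log2_affine_div_cvg0.
by exists (fun k => k%:R).
Qed.

Lemma apriori_cost_lower_bound (R : realType) (alpha beta : nat -> bool) :
  cost_lower_bound (fun k n => block_entropy R k n alpha beta / k%:R)
    (apriori_costs alpha beta).
Proof.
by apply: cost_lower_bound_of_log => _ [M [c ->]]; exact: apriori_complexity_ge_entropy.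
Qed.

Lemma gambling_cost_lower_bound (R : realType) (alpha beta : nat -> bool) :
  cost_lower_bound (fun k n => block_entropy R k n alpha beta / k%:R)
    (gambling_costs alpha beta).
Proof.
apply: cost_lower_bound_of_log => _ [G ->].
have [C C0 HC] := apriori_complexity_ge_entropy R alpha beta (strategy_process G) (gs_lookahead G).
exists C => // k N k0; apply: le_trans (HC k N k0) _.
exact: apriori_complexity_le_capital.
Qed.

Lemma automatic_cost_lower_bound (R : realType) (alpha beta : nat -> bool) :
  cost_lower_bound (fun k n => block_entropy R k n alpha beta / k%:R)
    (automatic_costs alpha beta).
Proof.
by apply: cost_lower_bound_of_log => _ [Gamma HG ->]; exact: automatic_complexity_ge_entropy.
Qed.

Lemma superadditive_cost_lower_bound (R : realType) (alpha beta : nat -> bool) :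
  cost_lower_bound (fun k n => block_entropy R k n alpha beta / k%:R)
    (superadditive_costs alpha beta).
Proof.
by apply: cost_lower_bound_of_log => _ [K HK ->]; exact: superadditive_measure_ge_entropy.
Qed.

Lemma gambling_cost_upper_bound (R : realType) (alpha beta : nat -> bool) :
  cost_upper_bound (fun k n => block_entropy R k n alpha beta / k%:R)
    (gambling_costs alpha beta).
Proof.
move=> k e k0 e0.
have [[|c] [w [mu [// _ Hmu _ [C HC]]]]] := universal_conditional_measure alpha beta k0 e0.
eexists; first by exists (measure_strategy c Hmu).
exists C => N; apply: (le_trans (measure_strategy_cost R c Hmu alpha beta N)).
rewrite lee_fin; apply: le_trans (HC N); apply: ler_sum => j _.
by rewrite lerDl.
Qed.

Lemma code_graph_upper_bound (R : realType) (alpha beta : nat -> bool) (k : nat) (e : R) :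
  (0 < k)%N -> 0 < e ->
  exists Gamma : labeled_graph, [/\ description_mode Gamma,
    (forall A B, size A = size B -> exists P, describes Gamma A B P) &
    exists C : R, forall N,
      (automatic_complexity R Gamma (substring alpha 0 N) (substring beta 0 N) <=
       (N%:R * (block_entropy R k (N %/ k) alpha beta / k%:R + e) + C)%:E)%E].
Proof.
move=> k0 e0.
have [L [w [mu [L0 Hmu Hw [C HC]]]]] := universal_conditional_measure alpha beta k0 e0.
have [Gamma [HG tot HN]] := exists_code_graph alpha beta L0 Hmu Hw.
exists Gamma; split => //; exists C => N; apply: le_trans (HN N) _.
by rewrite lee_fin; exact: HC.
Qed.

Lemma automatic_cost_upper_bound (R : realType) (alpha beta : nat -> bool) :
  cost_upper_bound (fun k n => block_entropy R k n alpha beta / k%:R)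
    (automatic_costs alpha beta).
Proof.
move=> k e k0 e0; have [Gamma [HG _ HC]] := code_graph_upper_bound alpha beta k0 e0.
by eexists; [exists Gamma|exact: HC].
Qed.

Lemma superadditive_cost_upper_bound (R : realType) (alpha beta : nat -> bool) :
  cost_upper_bound (fun k n => block_entropy R k n alpha beta / k%:R)
    (superadditive_costs alpha beta).
Proof.
move=> k e k0 e0; have [Gamma [HG tot [C HC]]] := code_graph_upper_bound alpha beta k0 e0.
eexists.
  by exists (fun A B => fine (automatic_complexity R Gamma A B)) => //;
    exact: superadditive_measure_automatic.
exists C => N; apply: le_trans (HC N).
(* The complexity lies between zero and a real number, so it is finite. *)
have := HC N; have := automatic_complexity_ge0 R Gamma (substring alpha 0 N) (substring beta 0 N).
by case: automatic_complexity.
Qed.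

Lemma apriori_cost_upper_bound (R : realType) (alpha beta : nat -> bool) :
  cost_upper_bound (fun k n => block_entropy R k n alpha beta / k%:R)
    (apriori_costs alpha beta).
Proof.
move=> k e k0 e0.
have [_ [G ->] [C HC]] := gambling_cost_upper_bound alpha beta k0 e0.
eexists; first by exists (strategy_process G), (gs_lookahead G).
by exists C => N; apply: le_trans (HC N); exact: apriori_complexity_le_capital.
Qed.

(** Subtraction from one exchanges lower and upper limits, so [Lam] and [Lam'] are a dual pair. *)
Lemma lam_gambling_cost (R : realType) (Lam Lam' : (nat -> \bar R) -> \bar R)
    (f : nat -> \bar R) : limit_functional Lam ->
  (forall u, Lam (fun N => 1 - u N)%E = (1 - Lam' u)%E) ->
  Lam (fun N => (N%:R%:E - f N) / N%:R%:E)%E = (1 - Lam' (fun N => f N / N%:R%:E))%E.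
Proof.
move=> HL HL'; rewrite -HL'.
(* The quotients agree for positive [N], which suffices for the limits. *)
have E : \forall N \near \oo, ((N%:R%:E - f N) / N%:R%:E = 1 - f N / N%:R%:E)%E.
  exists 1%N => // N /= N0.
  have N1 : N%:R != 0 :> R by rewrite pnatr_eq0 -lt0n.
  by rewrite inver (negbTE N1) muleBl ?fin_num_adde_defr// -EFinM divff.
apply/eqP; rewrite eq_le; apply/andP; split; apply: (lam_le HL);
  by apply: filterS E => N ->.
Qed.

(** For each class the infimum is the limit of the same sequence of entropy limits in [k];
    uniqueness of limits identifies the four infima. Superadditive measures provide the reference
    value [d]. *)
Lemma dimension_definitions_equivalent (R : realType) (alpha beta : nat -> bool)
    (Lam Lam' : (nat -> \bar R) -> \bar R) : limit_functional Lam ->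
  (forall u, Lam (fun N => 1 - u N)%E = (1 - Lam' u)%E) ->
  exists d : R,
    [/\ (fun k : nat => Lam (fun N : nat =>
           (block_entropy R k N alpha beta / k%:R)%:E)) @ \oo --> d%:E,
        (1 - ereal_sup [set x | exists G : gambling_strategy, x =
            Lam' (fun N : nat =>
              log2e (ratr (capital G (substring alpha 0 N)
                (substring beta 0 (N + gs_lookahead G)%N)) : R) / N%:R%:E)] = d%:E)%E,
        ereal_inf [set x | exists2 Gamma : labeled_graph,
            description_mode Gamma & x = Lam (fun N : nat =>
              (automatic_complexity R Gamma (substring alpha 0 N)
                (substring beta 0 N) / N%:R%:E)%E)] = d%:E,
        ereal_inf [set Lam (fun N : nat =>
              ((K (substring alpha 0 N) (substring beta 0 N))%:E / N%:R%:E)%E)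
            | K in [set K : bitstring -> bitstring -> R
                      | superadditive_measure K]] = d%:E &
        ereal_inf [set x | exists (M : prob_process) (c : nat), x =
            Lam (fun N : nat =>
              (apriori_complexity R M (substring alpha 0 N)
                (substring beta c N) / N%:R%:E)%E)] = d%:E].
Proof.
move=> HL HL'; have h01 := normalized_entropy_itv R alpha beta.
have [[d dE] cvg] := inf_cost_limit HL h01
  (@superadditive_cost_upper_bound R alpha beta)
  (@superadditive_cost_lower_bound R alpha beta).
rewrite dE in cvg.
have eqd Cl : cost_upper_bound (fun k n => block_entropy R k n alpha beta / k%:R) Cl ->
    cost_lower_bound (fun k n => block_entropy R k n alpha beta / k%:R) Cl ->
    ereal_inf [set Lam (fun N => (c N / N%:R%:E)%E) | c in Cl] = d%:E.
  move=> HU HW; have [_ cvg'] := inf_cost_limit HL h01 HU HW.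
  exact: (cvg_unique _ cvg' cvg).
exists d; split => //.
- rewrite -(eqd _ (@gambling_cost_upper_bound R alpha beta)
    (@gambling_cost_lower_bound R alpha beta)).
  rewrite -ereal_inf_1sub; congr ereal_inf; apply/seteqP; split.
    move=> _ [_ [G ->] <-]; eexists; first by exists G.
    exact: (lam_gambling_cost _ HL HL').
  move=> _ [_ [G ->] <-]; rewrite (lam_gambling_cost _ HL HL').
  by eexists; first by exists G.
- rewrite -(eqd _ (@automatic_cost_upper_bound R alpha beta)
    (@automatic_cost_lower_bound R alpha beta)).
  congr ereal_inf; apply/seteqP; split.
    by move=> _ [Gamma HG ->]; eexists; first by exists Gamma.
  by move=> _ [_ [Gamma HG ->] <-]; exists Gamma.
- rewrite -dE; congr ereal_inf; apply/seteqP; split.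
    by move=> _ [K HK <-]; eexists; first by exists K.
  by move=> _ [_ [K HK ->] <-]; exists K.
- rewrite -(eqd _ (@apriori_cost_upper_bound R alpha beta)
    (@apriori_cost_lower_bound R alpha beta)).
  congr ereal_inf; apply/seteqP; split.
    by move=> _ [M [c ->]]; eexists; first by exists M, c.
  by move=> _ [_ [M [c ->]] <-]; exists M, c.
Qed.

Lemma limn_einf_1sub (R : realType) (u : nat -> \bar R) :
  limn_einf (fun N => 1 - u N)%E = (1 - limn_esup u)%E.
Proof. by rewrite (limn_einf_shift (fun N => - u N)%E)// -limn_einfN. Qed.

Lemma limn_esup_1sub (R : realType) (u : nat -> \bar R) :
  limn_esup (fun N => 1 - u N)%E = (1 - limn_einf u)%E.
Proof.
have := lam_shift (limn_esup_functional R) (fun N => - u N)%E 1.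
by rewrite -limn_esupN.
Qed.

Local Open Scope ereal_scope.

Theorem mainTheorem1 (R : realType) (alpha beta : nat -> bool) :
  (exists d : R,
    [/\ (fun k : nat => limn_einf (fun N : nat =>
           (block_entropy R k N alpha beta / k%:R)%:E)) @ \oo --> d%:E,
        1 - ereal_sup [set x | exists G : gambling_strategy, x =
            limn_esup (fun N : nat =>
              log2e (ratr (capital G (substring alpha 0 N)
                (substring beta 0 (N + gs_lookahead G)%N)) : R) / N%:R%:E)] = d%:E,
        ereal_inf [set x | exists2 Gamma : labeled_graph,
            description_mode Gamma & x = limn_einf (fun N : nat =>
              automatic_complexity R Gamma (substring alpha 0 N)
                (substring beta 0 N) / N%:R%:E)] = d%:E,
        ereal_inf [set limn_einf (fun N : nat =>
              (K (substring alpha 0 N) (substring beta 0 N))%:E / N%:R%:E)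
            | K in [set K : bitstring -> bitstring -> R
                      | superadditive_measure K]] = d%:E &
        ereal_inf [set x | exists (M : prob_process) (c : nat), x =
            limn_einf (fun N : nat =>
              apriori_complexity R M (substring alpha 0 N)
                (substring beta c N) / N%:R%:E)] = d%:E])
  /\
  (exists d : R,
    [/\ (fun k : nat => limn_esup (fun N : nat =>
           (block_entropy R k N alpha beta / k%:R)%:E)) @ \oo --> d%:E,
        1 - ereal_sup [set x | exists G : gambling_strategy, x =
            limn_einf (fun N : nat =>
              log2e (ratr (capital G (substring alpha 0 N)
                (substring beta 0 (N + gs_lookahead G)%N)) : R) / N%:R%:E)] = d%:E,
        ereal_inf [set x | exists2 Gamma : labeled_graph,
            description_mode Gamma & x = limn_esup (fun N : nat =>
              automatic_complexity R Gamma (substring alpha 0 N)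
                (substring beta 0 N) / N%:R%:E)] = d%:E,
        ereal_inf [set limn_esup (fun N : nat =>
              (K (substring alpha 0 N) (substring beta 0 N))%:E / N%:R%:E)
            | K in [set K : bitstring -> bitstring -> R
                      | superadditive_measure K]] = d%:E &
        ereal_inf [set x | exists (M : prob_process) (c : nat), x =
            limn_esup (fun N : nat =>
              apriori_complexity R M (substring alpha 0 N)
                (substring beta c N) / N%:R%:E)] = d%:E]).
Proof.
split; apply: dimension_definitions_equivalent.
- exact: limn_einf_functional.
- exact: limn_einf_1sub.
- exact: limn_esup_functional.
- exact: limn_esup_1sub.
Qed.
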